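(* Let $d \ge 2$ be an integer. If the balanced supersaturation property $\mathrm{BS}(d)$ holds, then the random general position property $\mathrm{RGP}(d)$ also holds, where $\mathrm{BS}(d)$ and $\mathrm{RGP}(d)$ are the following statements. $\mathrm{BS}(d)$: There exist positive real constants $T, c, C'$ and $q_0$, depending only on $d$, such that for every prime power $q \ge q_0$ and every set $U \subseteq \mathbb{F}_q^d$ with $|U| \ge Tq$, there is a collection $\mathcal{H}_U \subseteq \mathcal{S}_{d+1}(U)$ such that (i) $|\mathcal{H}_U| \ge c\,|U|^{d+1}/q$, and (ii) $\Delta_i(\mathcal{H}_U) \le C'\,|U|^{d+1-i}/q^{1-\frac{i-1}{d}}$ for every integer $i \in \{1,2,\ldots,d\}$. $\mathrm{RGP}(d)$: There exist positive real constants $C, c_1, c_2$, depending only on $d$, such that for every function $p = p(q) \in [0,1]$ of the prime power $q$, with probability tending to $1$ as $q \to \infty$: (a) if $p = \omega(q^{-d})$ and $p = o(q^{-d+1/d})$, then $c_1\, p q^d \le \alpha(\mathbb{F}_q^d,p) \le c_2\, p q^d$; (b) if $C q^{-1+1/d}\log^2 q \le p \le 1$, then $c_1\, pq \le \alpha(\mathbb{F}_q^d,p) \le c_2\, pq$; (c) if $q^{-d+1/d}/\log q \le p < C q^{-1+1/d}\log^2 q$, then $c_1\, q^{1/d}/\log q \le \alpha(\mathbb{F}_q^d,p) \le c_2\, q^{1/d}\log^2 q$.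
   Context: $\mathbb{F}_q$ is the finite field with $q$ elements and $\mathbb{F}_q^d$ is the $d$-dimensional affine space over it. A $k$-flat is a $k$-dimensional affine subspace. A set $S \subseteq \mathbb{F}_q^d$ is in general position if no $d+1$ points of $S$ are contained in a $(d-1)$-flat. A $p$-random subset of $\mathbb{F}_q^d$ is obtained by including each point independently with probability $p$. $\alpha(\mathbb{F}_q^d,p)$ is the (random) maximum possible size of a point set in general position contained in a $p$-random subset of $\mathbb{F}_q^d$. For $U \subseteq \mathbb{F}_q^d$, $\mathcal{S}_{d+1}(U)$ is the collection of all $(d+1)$-element subsets of $U$ that are contained in some $(d-1)$-flat of $\mathbb{F}_q^d$. A collection $\mathcal{H} \subseteq \mathcal{S}_{d+1}(U)$ is viewed as a $(d+1)$-uniform hypergraph with vertex set $U$. $|\mathcal{H}|$ denotes its number of edges. For $S \subseteq U$, $d_{\mathcal{H}}(S)$ is the number of edges of $\mathcal{H}$ containing $S$, and $\Delta_i(\mathcal{H})$ is the maximum of $d_{\mathcal{H}}(S)$ over all $S \subseteq U$ with $|S| = i$. The conditions on $p$ in (a), (b), (c) are conditions on the function $q \mapsto p(q)$: $p=\omega(f)$ means $p(q)/f(q)\to\infty$ and $p=o(f)$ means $p(q)/f(q)\to 0$ as $q\to\infty$ over prime powers, and the inequalities in (b) and (c) are required for all sufficiently large prime powers $q$. In each case the asserted two-sided bound holds with probability tending to $1$ as $q\to\infty$. *)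

(* Defs.v *)
From HB Require Import structures.
From mathcomp Require Import all_boot all_order all_algebra all_field.
From mathcomp Require Import all_classical all_reals all_analysis.

Set Implicit Arguments.
Unset Strict Implicit.
Unset Printing Implicit Defensive.

Import Order.TTheory GRing.Theory Num.Theory.
Import numFieldNormedType.Exports.

Local Open Scope ring_scope.

Definition prime_power : set nat :=
  [set q | exists p k : nat, [/\ prime p, (0 < k)%N & q = (p ^ k)%N]].

(* The field with q elements, chosen among the finite fields of order q; the
   value 'F_2 is junk, taken only when q is not a prime power. *)
Definition GF (q : nat) : finFieldType :=
  if pselect (exists F : finFieldType, #|F| = q) is left exF
  then projT1 (cid exF) else 'F_2.

Lemma card_GF (q : nat) : prime_power q -> #|GF q| = q.
Proof.
move=> [p [k [p_pr k_gt0 ->]]]; rewrite /GF.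
case: pselect => [exF|[]]; first by case: (cid exF).
by have [F _ cardF] := pPrimePowerField p_pr k_gt0; exists F.
Qed.

Section Geometry.
Variables (F : finFieldType) (d : nat).
Implicit Types (A S U E : {set 'rV[F]_d}) (H : {set {set 'rV[F]_d}}).

(* Linear subspaces of F^d are given as row spaces of matrices M, whose
   dimension is \rank M. *)
Definition is_flat (k : nat) A : bool :=
  [exists a : 'rV[F]_d, [exists M : 'M[F]_d,
     (\rank M == k) && (A == [set x | (x - a <= M)%MS])]].

Definition in_hyperplane A : bool :=
  [exists P : {set 'rV[F]_d}, is_flat d.-1 P && (A \subset P)].

Definition general_position S : bool :=
  [forall E : {set 'rV[F]_d},
     (E \subset S) && (#|E| == d.+1) ==> ~~ in_hyperplane E].

Definition alpha A : nat :=
  \max_(S : {set 'rV[F]_d} | (S \subset A) && general_position S) #|S|.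

Definition degenerate_sets U : {set {set 'rV[F]_d}} :=
  [set E : {set 'rV[F]_d} | [&& E \subset U, #|E| == d.+1 & in_hyperplane E]].

Definition degree H S : nat := #|[set E in H | S \subset E]|.

Definition max_degree U H (i : nat) : nat :=
  \max_(S : {set 'rV[F]_d} | (S \subset U) && (#|S| == i)) degree H S.

End Geometry.

(* Probability that the p-random subset of T (each point kept independently
   with probability p) satisfies P: the sum over A of p^|A| (1-p)^(|T|-|A|). *)
Definition random_subset_prob (R : realType) (T : finType) (p : R)
    (P : pred {set T}) : R :=
  \sum_(A : {set T} | P A) \prod_(x : T) (if x \in A then p else 1 - p).

Section Properties.
Local Open Scope classical_set_scope.
Local Open Scope ring_scope.
Variables (R : realType) (d : nat).

Local Notation W := (within prime_power \oo).

Definition balanced_supersaturation : Prop :=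
  exists T c C' q0 : R, [/\ 0 < T, 0 < c, 0 < C' & 0 < q0] /\
  forall q : nat, prime_power q -> q0 <= q%:R ->
  forall U : {set 'rV[GF q]_d}, T * q%:R <= #|U|%:R ->
  exists H : {set {set 'rV[GF q]_d}},
    [/\ H \subset degenerate_sets U,
        c * #|U|%:R ^+ d.+1 / q%:R <= #|H|%:R
      & forall i : nat, (1 <= i <= d)%N ->
          (max_degree U H i)%:R <=
            C' * #|U|%:R ^+ (d.+1 - i)%N / q%:R `^ (1 - (i%:R - 1) / d%:R)].

Definition whp_alpha_between (p lo hi : nat -> R) : Prop :=
  random_subset_prob (p q)
    [pred A : {set 'rV[GF q]_d} | lo q <= (alpha A)%:R <= hi q]
  @[q --> W] --> (1 : R).

Definition random_general_position : Prop :=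
  exists C c1 c2 : R, [/\ 0 < C, 0 < c1 & 0 < c2] /\
  forall p : nat -> R, (forall q, prime_power q -> 0 <= p q <= 1) ->
  [/\ (p q / q%:R `^ (- d%:R) @[q --> W] --> +oo ->
       p q / q%:R `^ (- d%:R + d%:R^-1) @[q --> W] --> (0 : R) ->
       whp_alpha_between p
         (fun q => c1 * p q * q%:R ^+ d) (fun q => c2 * p q * q%:R ^+ d)),
      ((\forall q \near W,
          C * q%:R `^ (-1 + d%:R^-1) * ln q%:R ^+ 2 <= p q <= 1) ->
       whp_alpha_between p
         (fun q => c1 * p q * q%:R) (fun q => c2 * p q * q%:R))
    & ((\forall q \near W,
          q%:R `^ (- d%:R + d%:R^-1) / ln q%:R <= p q
            < C * q%:R `^ (-1 + d%:R^-1) * ln q%:R ^+ 2) ->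
       whp_alpha_between p
         (fun q => c1 * (q%:R `^ d%:R^-1 / ln q%:R))
         (fun q => c2 * (q%:R `^ d%:R^-1 * ln q%:R ^+ 2)))].

End Properties.

(* Main.v *)
(* Balanced supersaturation feeds the hypergraph container method: every set in
   general position lies in one of exp(O(q^(1/d) log^2 q)) containers of size
   O(q). A union bound with Chernoff's inequality over the containers then gives
   the upper bounds in (b) and (c); in (a) the upper bound is the size of the
   random set itself. For the lower bounds, the random set either meets the moment
   curve in about pq points, which are in general position (b), or contains
   fewer degenerate (d+1)-sets than points, one point of each of which is deleted
   (a); (c) follows from (a) at p = q^(-d+1/d)/log q by monotonicity in p.

   The containers are found by induction on the uniformity r of a weighted
   hypergraph w. Read a vertex v of high degree off the independent set I
   and add the link of v to an (r-1)-uniform hypergraph g, ignoring the edges of w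
   that contain a set whose codegree in g has become too large. If at some
   point I has no vertex of high degree, the complement of these vertices is a
   container; otherwise after m steps g is a balanced (r-1)-uniform hypergraph
   in which I is still independent. *)
Require Import Defs.
From mathcomp Require Import all_boot all_order all_algebra.
From mathcomp Require Import all_classical all_reals all_analysis.
From mathcomp Require Import ring lra.

Set Implicit Arguments.
Unset Strict Implicit.
Unset Printing Implicit Defensive.

Import Order.TTheory GRing.Theory Num.Theory.
Import numFieldNormedType.Exports.

Local Open Scope ring_scope.

(** * Random subsets *)

Definition subset_weight (R : realType) (T : finType) (p : R) (A : {set T}) : R :=
  \prod_(x : T) (if x \in A then p else 1 - p).

Section RandomSubset.
Variables (R : realType) (T : finType).
Implicit Types (p z h : R) (S A D : {set T}) (P Q : pred {set T}).

Lemma subset_weight_ge0 p A : 0 <= p <= 1 -> 0 <= subset_weight p A.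
Proof.
move=> /andP[p0 p1]; apply: prodr_ge0 => x _.
by case: ifP => // _; rewrite subr_ge0.
Qed.

Lemma sum_subset_weight p : \sum_(A : {set T}) subset_weight p A = 1.
Proof.
rewrite /subset_weight -(bigA_distr _ _ (fun=> p) (fun=> 1 - p)).
by rewrite big1 // => x _; rewrite /= addrC subrK.
Qed.

Lemma random_subset_probE p P :
  random_subset_prob p P = \sum_(A | P A) subset_weight p A.
Proof. by []. Qed.

Lemma random_subset_prob_ge0 p P : 0 <= p <= 1 -> 0 <= random_subset_prob p P.
Proof. by move=> p01; apply: sumr_ge0 => A _; apply: subset_weight_ge0. Qed.

Lemma random_subset_probC p P :
  random_subset_prob p P = 1 - random_subset_prob p (predC P).
Proof.
rewrite -(sum_subset_weight p) (bigID P) /=.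
by rewrite !random_subset_probE addrK.
Qed.

Lemma random_subset_prob_le p P Q : 0 <= p <= 1 -> {subset P <= Q} ->
  random_subset_prob p P <= random_subset_prob p Q.
Proof.
move=> p01 PQ; rewrite !random_subset_probE [leRHS](bigID P) /=.
rewrite (eq_bigl P) => [|A]; last first.
  by apply/andP/idP => [[]|PA] //; split=> //; exact: PQ.
by rewrite lerDl; apply: sumr_ge0 => A _; apply: subset_weight_ge0.
Qed.

Lemma markov_random_subset p P (f : {set T} -> R) h :
  0 <= p <= 1 -> 0 < h -> (forall A, 0 <= f A) -> (forall A, P A -> h <= f A) ->
  random_subset_prob p P <= (\sum_A subset_weight p A * f A) / h.
Proof.
move=> p01 h0 f0 Pf; rewrite ler_pdivlMr// random_subset_probE mulr_suml.
rewrite [leRHS](bigID P) /= -[leLHS]addr0; apply: lerD; last first.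
  by apply: sumr_ge0 => A _; rewrite mulr_ge0// subset_weight_ge0.
by apply: ler_sum => A PA; rewrite ler_wpM2l ?subset_weight_ge0 ?Pf.
Qed.

(** The weight is a product over points, so the sum over [A] factors. This is the generating
    function of a binomial variable, the source of both Chernoff bounds. *)
Lemma subset_weight_mgf p z S :
  \sum_A subset_weight p A * z ^+ #|A :&: S| = (1 - p + p * z) ^+ #|S|.
Proof.
pose F x := p * (if x \in S then z else 1).
transitivity (\prod_(x : T) (F x + (1 - p))).
  rewrite bigA_distr; apply: eq_bigr => A _.
  rewrite /subset_weight -prodr_const.
  rewrite (big_mkcond (fun x => x \in A :&: S)) -big_split /=.
  apply: eq_bigr => x _; rewrite inE /F.
  by case: (x \in A); case: (x \in S); rewrite /= ?mulr1.
rewrite -prodr_const [RHS]big_mkcond; apply: eq_bigr => x _.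
by rewrite /F; case: ifP => _; rewrite 1?addrC// mulr1 subrK.
Qed.

Lemma prob_subset p S : random_subset_prob p [pred A : {set T} | S \subset A] = p ^+ #|S|.
Proof.
(* The factor 0 for a missing point of [S] removes every [A] that does not contain [S]. *)
transitivity (\prod_(x : T) (p + (if x \in S then 0 else 1 - p))).
  rewrite bigA_distr random_subset_probE big_mkcond; apply: eq_bigr => A _ /=.
  case: ifP => [/fintype.subsetP SA|/negbT/fintype.subsetPn[x xS xA]]; last first.
    by rewrite (bigD1 x)//= xS (negbTE xA) mul0r.
  apply: eq_bigr => x _; case: ifP => // xA; case: ifP => // /SA.
  by rewrite xA.
rewrite -prodr_const [RHS]big_mkcond; apply: eq_bigr => x _.
by case: ifP => _; rewrite ?addr0// addrC subrK.
Qed.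

Lemma expected_num_subsets p (H : {set {set T}}) r :
  (forall E, E \in H -> #|E| = r) ->
  \sum_A subset_weight p A * #|[set E in H | E \subset A]|%:R = #|H|%:R * p ^+ r.
Proof.
move=> Hr.
transitivity (\sum_(A : {set T}) \sum_(E in H) (if E \subset A then subset_weight p A else 0)).
  apply: eq_bigr => A _; rewrite -big_mkcondr /= sumr_const mulr_natr.
  by congr (_ *+ _); apply: eq_card => E; rewrite !inE.
rewrite exchange_big /= (eq_bigr (fun=> p ^+ r)).
  by rewrite sumr_const mulr_natl.
move=> E /Hr <-; rewrite -big_mkcond /= -prob_subset.
exact: eq_bigl.
Qed.

(* Thinning a p-random set by an independent s-random set yields a ps-random set. *)
Lemma random_subset_prob_mono p p' P : 0 <= p' -> p' <= p -> p <= 1 ->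
  (forall A D, D \subset A -> P D -> P A) ->
  random_subset_prob p' P <= random_subset_prob p P.
Proof.
move=> p'0 p'p p1 Pup.
(* The thinning rate [p' / p] needs [p > 0]; otherwise [p] and [p'] coincide. *)
have [p0|p0] := leP p 0.
  have -> : p' = p.
    apply/eqP; rewrite eq_le p'p /=.
    exact: le_trans p0 p'0.
  exact: lexx.
pose s := p' / p.
have s01 : 0 <= s <= 1.
  by rewrite divr_ge0 ?(ltW p0)//= ler_pdivrMr// mul1r p'p.
have psE : p * s = p' by rewrite mulrC divfK// gt_eqF.
clearbody s.
(* Joint law of the [p]-random set [A] and its thinning [D]: it vanishes unless [D] lies in [A], and
   its marginals are the two weights. *)
pose k A D : R := \prod_(x : T) (if x \in A then
  (if x \in D then p * s else p * (1 - s)) else (if x \in D then 0 else 1 - p)).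
have k_ge0 A D : 0 <= k A D.
  move: s01 => /andP[s0 s1]; apply: prodr_ge0 => x _.
  have ? := ltW p0; case: ifP => _; case: ifP => _; rewrite ?mulr_ge0 ?subr_ge0 ?lexx //.
have kA D : subset_weight p' D = \sum_A k A D.
  rewrite /k -(bigA_distr _ _ (fun x => if x \in D then p * s else p * (1 - s))
     (fun x => if x \in D then 0 else 1 - p)).
  apply: eq_bigr => x _; case: ifP => _ /=; rewrite ?addr0 ?psE//.
  by rewrite mulrBr psE; ring.
have kD A : subset_weight p A = \sum_D k A D.
  pose F x := if x \in A then p * s else 0.
  pose G x := if x \in A then p * (1 - s) else 1 - p.
  transitivity (\prod_(x : T) (F x + G x)).
    apply: eq_bigr => x _; rewrite /F /G; case: ifP => _; last by rewrite add0r.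
    by rewrite -mulrDr addrC subrK mulr1.
  rewrite bigA_distr; apply: eq_bigr => D _; apply: eq_bigr => x _.
  by rewrite /F /G; case: (x \in A); case: (x \in D).
rewrite !random_subset_probE.
under eq_bigr do rewrite kA; under [leRHS]eq_bigr do rewrite kD.
rewrite exchange_big /= [leRHS]big_mkcond /=; apply: ler_sum => A _.
case: ifPn => PA; last first.
  rewrite big1// => D PD; have : ~~ (D \subset A).
    by apply: contra PA => DA; apply: Pup PD.
  by case/fintype.subsetPn => x xD xA; rewrite /k (bigD1 x)//= xD (negbTE xA) mul0r.
by rewrite [leRHS](bigID P) /= lerDl; apply: sumr_ge0 => D _.
Qed.

(** Markov's inequality for [e ^ #|A :&: S|], with [1 - p + p * e <= expR (e * p)]. *)
Lemma chernoff_upper p h S : 0 <= p <= 1 ->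
  random_subset_prob p [pred A : {set T} | h <= #|A :&: S|%:R]
    <= expR (expR 1 * p * #|S|%:R - h).
Proof.
move=> p01; apply: le_trans (markov_random_subset p01 (expR_gt0 h)
  (f := fun A => expR 1 ^+ #|A :&: S|) _ _) _.
- by move=> A; rewrite exprn_ge0// expR_ge0.
- by move=> A /= hA; rewrite -expRM_natr mul1r ler_expR.
rewrite subset_weight_mgf expRD expRN ler_wpM2r ?invr_ge0 ?expR_ge0//.
rewrite -mulrA [X in expR (_ * X)]mulrC mulrA mulrAC.
move: p01 => /andP[p0 p1].
rewrite expRM_natr lerXn2r// ?nnegrE ?expR_ge0//.
  by rewrite addr_ge0 ?subr_ge0// mulr_ge0 ?expR_ge0.
apply: le_trans (expR_ge1Dx _); rewrite [p * _]mulrC.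
by rewrite lerD2r lerBlDr lerDl.
Qed.

(** Markov's inequality for [e ^ (- #|A :&: S|)]; since [e >= 2], [1 - p + p / e <= 1 - p / 2 <=
    expR (- p / 2)]. *)
Lemma chernoff_lower p h S : 0 <= p <= 1 ->
  random_subset_prob p [pred A : {set T} | #|A :&: S|%:R <= h]
    <= expR (h - p * #|S|%:R / 2).
Proof.
move=> p01; apply: le_trans (markov_random_subset p01 (expR_gt0 (- h))
  (f := fun A => expR (-1) ^+ #|A :&: S|) _ _) _.
- by move=> A; rewrite exprn_ge0// expR_ge0.
- by move=> A /= hA; rewrite -expRM_natr mulN1r ler_expR lerN2.
rewrite subset_weight_mgf -expRN opprK mulrC expRD ler_wpM2l ?expR_ge0//.
move: p01 => /andP[p0 p1].
have -> : - (p * #|S|%:R / 2) = (- (p / 2)) * #|S|%:R :> R by ring.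
have e2 : expR (-1) <= 2^-1 :> R.
  rewrite expRN lef_pV2 ?posrE ?expR_gt0//.
  by apply: le_trans (expR_ge1Dx _); lra.
rewrite expRM_natr lerXn2r// ?nnegrE ?expR_ge0//.
  by rewrite addr_ge0 ?subr_ge0// mulr_ge0 ?expR_ge0.
apply: le_trans (expR_ge1Dx _).
have : p * expR (-1) <= p * 2^-1 by rewrite ler_wpM2l.
lra.
Qed.

Lemma random_subset_prob_bigcup p (I : finType) (J : {set I}) (Q : I -> pred {set T}) P (b : R) :
  0 <= p <= 1 -> (forall A, P A -> exists2 i, i \in J & Q i A) ->
  (forall i, i \in J -> random_subset_prob p (Q i) <= b) ->
  random_subset_prob p P <= #|J|%:R * b.
Proof.
move=> p01 PQ Qb.
have : \sum_(i in J) random_subset_prob p (Q i) <= #|J|%:R * b.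
  by rewrite mulr_natl -sumr_const; apply: ler_sum.
apply: le_trans.
under [leRHS]eq_bigr do rewrite random_subset_probE big_mkcond /=.
rewrite exchange_big /= random_subset_probE big_mkcond; apply: ler_sum => A _.
have k0 i : 0 <= if Q i A then subset_weight p A else 0.
  by case: ifP => // _; apply: subset_weight_ge0.
case: ifP => [/PQ[i iJ QiA]|_]; last exact: sumr_ge0.
by rewrite (bigD1 i)//= QiA lerDl sumr_ge0.
Qed.

Lemma random_subset_probU p P P1 P2 :
  0 <= p <= 1 -> (forall A, P A -> P1 A || P2 A) ->
  random_subset_prob p P <= random_subset_prob p P1 + random_subset_prob p P2.
Proof.
move=> p01 PQ; rewrite !random_subset_probE [leLHS]big_mkcond.
rewrite [X in _ <= X + _]big_mkcond [X in _ <= _ + X]big_mkcond -big_split /=.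
apply: ler_sum => A _; have := subset_weight_ge0 A p01.
by case: (boolP (P A)) => [/PQ|_]; case: (P1 A); case: (P2 A) => //=; lra.
Qed.

End RandomSubset.

(** * Hyperplanes and general position *)

Lemma leq_bin_exp n k : ('C(n, k) <= n ^ k)%N.
Proof.
apply: (@leq_trans (n ^_ k)); first by rewrite -bin_ffact leq_pmulr// fact_gt0.
elim: k n => [|k IH] n //; rewrite ffactnS expnS leq_mul2l.
rewrite (leq_trans (IH _)) ?orbT//.
by case: k {IH} => // k; rewrite leq_exp2r// leq_pred.
Qed.

Lemma leq_card_bigcup (I T : finType) (P : pred I) (A : I -> {set T}) :
  (#|\bigcup_(i | P i) A i| <= \sum_(i | P i) #|A i|)%N.
Proof.
elim/big_rec2: _ => [|i m B _ IH]; first by rewrite cards0.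
by rewrite (leq_trans (leq_card_setU _ _))// leq_add2l.
Qed.

Section AffineGeometry.
Variables (F : finFieldType) (d : nat).
Hypothesis d_gt0 : (0 < d)%N.
Implicit Types (A S E : {set 'rV[F]_d}) (x y : 'rV[F]_d) (j : 'I_d).

(* Every hyperplane has an equation [x . n = b] with some coordinate [n_j = 1];
   [y] stores [n] with its [j]-th entry replaced by [b]. *)
Definition normalized_hyperplane (jy : 'I_d * 'rV[F]_d) : {set 'rV[F]_d} :=
  [set x : 'rV[F]_d | x 0 jy.1 + \sum_(i | i != jy.1) x 0 i * jy.2 0 i == jy.2 0 jy.1].

(** [M] has rank below [d], so some [u != 0] is orthogonal to all its rows and serves as the normal
    vector. *)
Lemma in_hyperplane_equation A : in_hyperplane A ->
  exists n : 'I_d -> F, exists b : F,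
    (exists j, n j != 0) /\ forall x, x \in A -> \sum_i x 0 i * n i = b.
Proof.
move=> /existsP[P /andP[/existsP[a /existsP[M /andP[/eqP rM /eqP ->]]] AP]].
have : kermx M^T != 0.
  rewrite kermx_eq0 /row_free mxrank_tr rM neq_ltn prednK//.
  by rewrite leqnn.
move=> /rowV0Pn[u /sub_kermxP uM u0].
exists (fun i => u 0 i), ((a *m u^T) 0 0); split.
  apply/existsP; apply: contraR u0; rewrite negb_exists => /forallP u0.
  by apply/eqP/rowP => i; rewrite mxE; apply/eqP; have := u0 i; rewrite negbK.
move=> x /(fintype.subsetP AP); rewrite inE => /submxP[D xD].
have : (x - a) *m u^T = 0.
  by rewrite xD -mulmxA -[M]trmxK -trmx_mul uM trmx0 mulmx0.
rewrite mulmxBl => /eqP; rewrite subr_eq0 => /eqP <-; rewrite mxE.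
by apply: eq_bigr => i _; rewrite mxE.
Qed.

Lemma in_normalized_hyperplane A : in_hyperplane A ->
  exists jy, A \subset normalized_hyperplane jy.
Proof.
move=> /in_hyperplane_equation[n [b [[j nj] Anb]]].
exists (j, \row_i (if i == j then b / n j else n i / n j)).
apply/fintype.subsetP => x xA; rewrite inE /= !mxE eqxx.
apply/eqP; apply: (mulIf nj); rewrite divfK// -(Anb _ xA) [RHS](bigD1 j)//= mulrDl.
congr (_ + _); rewrite mulr_suml; apply: eq_bigr => i /negbTE ij.
by rewrite mxE ij -mulrA divfK.
Qed.

(** The equation recovers the coordinate [jy.1] from the others, so deleting it is injective on the
    hyperplane. *)
Lemma card_normalized_hyperplane jy :
  (#|normalized_hyperplane jy| <= #|F| ^ d.-1)%N.
Proof.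
have -> : (#|F| ^ d.-1 = #|{: 'rV[F]_d.-1}|)%N by rewrite card_mx mul1n.
rewrite -(card_in_imset (f := col' jy.1)) ?max_card//.
move=> x y; rewrite !inE => /eqP xP /eqP yP xy.
have xyi i : i != jy.1 -> x 0 i = y 0 i.
  rewrite eq_sym => /unlift_some[k -> _].
  by have /rowP/(_ k) := xy; rewrite !mxE.
apply/rowP => i; have [->{i}|/xyi//] := eqVneq i jy.1.
move: xP; rewrite -yP.
have -> : \sum_(i | i != jy.1) x 0 i * jy.2 0 i = \sum_(i | i != jy.1) y 0 i * jy.2 0 i.
  by apply: eq_bigr => i /xyi ->.
exact: addIr.
Qed.

(** There are [d * #|F| ^ d] normalized equations, and each hyperplane has at most
    [(#|F| ^ d.-1) ^ d.+1] subsets of size [d.+1]. *)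
Lemma card_degenerate_sets :
  (#|@degenerate_sets F d [set: _]| <= d * #|F| ^ (d + d.-1 * d.+1))%N.
Proof.
pose K jy := [set E : {set 'rV[F]_d} | E \subset normalized_hyperplane jy & #|E| == d.+1].
have /subset_leq_card/leq_trans-> // :
    @degenerate_sets F d [set: _] \subset \bigcup_jy K jy.
  apply/fintype.subsetP => E; rewrite inE => /and3P[_ cE].
  move=> /in_normalized_hyperplane[jy Ejy].
  by apply/bigcupP; exists jy => //; rewrite inE Ejy.
apply: leq_trans (leq_card_bigcup _ _) _.
apply: (@leq_trans (\sum_(jy : 'I_d * 'rV[F]_d) #|F| ^ (d.-1 * d.+1))).
  apply: leq_sum => jy _; rewrite cards_draws expnM.
  apply: leq_trans (leq_bin_exp _ _) _.
  by rewrite leq_exp2r// card_normalized_hyperplane.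
by rewrite sum_nat_const card_prod card_ord card_mx mul1n -mulnA -expnD.
Qed.

Lemma alpha_le_card A : (alpha A <= #|A|)%N.
Proof. by apply/bigmax_leqP => S /andP[SA _]; apply: subset_leq_card. Qed.

Lemma alpha_mono A (B : {set 'rV[F]_d}) : A \subset B -> (alpha A <= alpha B)%N.
Proof.
move=> AB; apply/bigmax_leqP => S /andP[SA GS].
by apply: (leq_bigmax_cond (F := fun S : {set 'rV[F]_d} => #|S|)); rewrite (fintype.subset_trans SA).
Qed.

Lemma alpha_witness A : exists S, [/\ S \subset A, general_position S & #|S| = alpha A].
Proof.
pose P := [pred S : {set 'rV[F]_d} | (S \subset A) && general_position S].
have P0 : (0 < #|P|)%N.
  apply/card_gt0P; exists finset.set0; rewrite inE finset.sub0set; apply/forallP => E.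
  apply/implyP => /andP[]; rewrite finset.subset0 => /eqP ->.
  by rewrite cards0.
have [S /andP[SA GS] aS] := eq_bigmax_cond (fun S : {set 'rV[F]_d} => #|S|) P0.
by exists S; split => //; rewrite -aS.
Qed.

(* Deleting one point from each degenerate subset of A leaves a set in general
   position. *)
Lemma alpha_deletion A :
  (#|A| <= alpha A + #|[set E in @degenerate_sets F d [set: _] | E \subset A]|)%N.
Proof.
set D := [set E in _ | _].
pose pt (E : {set 'rV[F]_d}) := odflt 0 [pick x in E].
have ptE E : (0 < #|E|)%N -> pt E \in E.
  by rewrite /pt; case: pickP => //= E0; rewrite (eq_card0 E0).
pose S := A :\: [set pt E | E in D].
have GS : general_position S.
  apply/forallP => E; apply/implyP => /andP[ES /eqP cE]; apply/negP => hE.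
  have EA : E \subset A by apply: fintype.subset_trans ES _; apply: finset.subsetDl.
  have ED : E \in D by rewrite !inE finset.subsetT cE eqxx hE EA.
  have := fintype.subsetP ES _ (ptE E _); rewrite cE => /(_ isT).
  by rewrite inE imset_f.
have aS : (#|S| <= alpha A)%N.
  by apply: (leq_bigmax_cond (F := fun S : {set 'rV[F]_d} => #|S|)); rewrite finset.subsetDl.
have -> : #|A| = (#|A :&: [set pt E | E in D]| + #|S|)%N by rewrite finset.cardsID.
rewrite addnC leq_add//; apply: leq_trans (leq_imset_card pt D).
by rewrite subset_leq_card// finset.subsetIr.
Qed.

Definition moment_point (x : F) : 'rV[F]_d := \row_(i < d) x ^+ i.+1.

Lemma moment_point_inj : injective moment_point.
Proof.
by move=> x y /rowP/(_ (Ordinal d_gt0)); rewrite !mxE !expr1.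
Qed.

Definition moment_curve : {set 'rV[F]_d} := [set moment_point x | x : F].

Lemma card_moment_curve : #|moment_curve| = #|F|.
Proof. by rewrite card_imset//; apply: moment_point_inj. Qed.

(** Along the curve, the equation of a hyperplane becomes a non-zero polynomial of degree at most
    [d] in the parameter, which cannot have [d + 1] roots. *)
Lemma general_position_moment_curve S :
  S \subset moment_curve -> general_position S.
Proof.
move=> SM; apply/forallP => E; apply/implyP => /andP[ES /eqP cE].
apply/negP => /in_hyperplane_equation[n [b [[j nj] Enb]]].
(* Coefficients are indexed by naturals, so [n] is extended by 0. The shift by [cons_poly] below
   matches the exponents [i.+1] of [moment_point]. *)
pose n' k := if insub k is Some i then n i else 0.
have n'E (i : 'I_d) : n' i = n i by rewrite /n' valK.
pose p : {poly F} := cons_poly (- b) (\poly_(i < d) n' i).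
have pE (x : F) : moment_point x \in E -> p.[x] = 0.
  move=> /Enb xb; rewrite horner_cons horner_poly -xb mulr_suml.
  apply/eqP; rewrite subr_eq0; apply/eqP; apply: eq_bigr => i _.
  by rewrite mxE n'E exprS; ring.
have p0 : p != 0.
  apply: contra nj => /eqP p0; have : p`_j.+1 = 0 by rewrite p0 coef0.
  by rewrite coef_cons /= coef_poly ltn_ord n'E => ->.
have sp : (size p <= d.+1)%N.
  by rewrite size_cons_poly; case: ifP => // _; rewrite ltnS size_poly.
pose X := [set x | moment_point x \in E].
have EX : E = moment_point @: X.
  apply/setP => y; apply/idP/imsetP => [yE|[x]]; last by rewrite inE => xE ->.
  have /imsetP[x _ yx] := fintype.subsetP (fintype.subset_trans ES SM) _ yE.
  by exists x => //; rewrite inE -yx.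
have cX : #|X| = d.+1 by rewrite -cE EX card_imset//; apply: moment_point_inj.
have : all (root p) (enum X).
  by apply/allP => x; rewrite mem_enum inE => /pE px; apply/rootP.
move=> /(max_poly_roots p0)/(_ (enum_uniq _)).
by rewrite -cardE cX ltnNge sp.
Qed.

Lemma alpha_moment_curve A : (#|A :&: moment_curve| <= alpha A)%N.
Proof.
apply: (leq_bigmax_cond (F := fun S : {set 'rV[F]_d} => #|S|)).
by rewrite finset.subsetIl general_position_moment_curve// finset.subsetIr.
Qed.

End AffineGeometry.

(** * Hypergraph containers *)

Section Weights.
Variables (R : realType) (V : finType).
Implicit Types (U T E I : {set V}) (w a g : {set V} -> R) (v : V).

(** Hypergraphs are weight functions rather than sets of edges, so that the links of several
    vertices can be added with multiplicity. *)
Definition codegree w T : R := \sum_(E : {set V} | T \subset E) w E.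

Definition total_weight w : R := \sum_(E : {set V}) w E.

Definition uniform_weight U r w : Prop :=
  (forall E, 0 <= w E) /\ (forall E, w E != 0 -> E \subset U /\ #|E| = r).

Definition independent w I : Prop := forall E, w E != 0 -> ~~ (E \subset I).

Definition link w v : {set V} -> R := fun T => if v \in T then 0 else w (v |: T).

Lemma codegree_ge0 w T : (forall E, 0 <= w E) -> 0 <= codegree w T.
Proof. by move=> w0; apply: sumr_ge0. Qed.

Lemma codegree_le w a T : (forall E, a E <= w E) -> codegree a T <= codegree w T.
Proof. by move=> aw; apply: ler_sum. Qed.

Lemma codegreeD w a T :
  codegree (fun E => w E + a E) T = codegree w T + codegree a T.
Proof. exact: big_split. Qed.

(** Adding [v] is a bijection from the sets avoiding [v] to the sets containing it, and the link is
    0 on the latter. *)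
Lemma codegree_link_notin w v T :
  v \notin T -> codegree (link w v) T = codegree w (v |: T).
Proof.
move=> vT; rewrite /codegree [RHS](reindex_onto (fun E => v |: E) (fun E => E :\ v)).
  rewrite big_mkcond [RHS]big_mkcond; apply: eq_bigr => E _ /=.
  rewrite /link; case: (boolP (v \in E)) => vE.
    have -> : (v |: E) :\ v == E = false; last by rewrite andbF; case: ifP.
    by apply/negbTE; apply: contraL vE => /eqP <-; rewrite !inE eqxx.
  rewrite finset.setU1K// eqxx andbT; congr (if _ then _ else _).
  apply/fintype.subsetP/fintype.subsetP => [TE x|vTE x xT].
    by rewrite !inE => /orP[->//|/TE ->]; rewrite orbT.
  have := vTE x; rewrite !inE xT orbT => /(_ isT) /orP[/eqP xv|//].
  by rewrite -xv xT in vT.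
by move=> E vTE; rewrite finset.setD1K// (fintype.subsetP vTE)// finset.setU11.
Qed.

Lemma codegree_link_in w v T : v \in T -> codegree (link w v) T = 0.
Proof.
move=> vT; apply: big1 => E /fintype.subsetP/(_ v vT) vE.
by rewrite /link vE.
Qed.

Lemma total_weight_link w v : total_weight (link w v) = codegree w [set v].
Proof.
have := @codegree_link_notin w v finset.set0; rewrite inE finset.setU0 => <-//.
by apply: eq_bigl => E; rewrite finset.sub0set.
Qed.

(** Double counting: an edge of size [r] is counted once for each of its [2 ^ r] subsets. *)
Lemma sum_codegree U r w : uniform_weight U r w ->
  \sum_(T : {set V}) codegree w T = (2 ^ r)%:R * total_weight w.
Proof.
move=> [_ wU]; rewrite /codegree; under eq_bigr do rewrite big_mkcond.
rewrite exchange_big mulr_sumr; apply: eq_bigr => E _ /=.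
have [->|/wU[_ cE]] := eqVneq (w E) 0.
  by rewrite mulr0 big1// => T _; case: ifP.
rewrite -big_mkcond sumr_const mulr_natl -cE -card_powerset.
by congr (_ *+ _); apply: eq_card => T; rewrite !inE.
Qed.

Lemma sum_vertex_degree U r w : uniform_weight U r w ->
  \sum_(v in U) codegree w [set v] = r%:R * total_weight w.
Proof.
move=> [_ wU]; rewrite /codegree.
under eq_bigr do rewrite big_mkcond.
rewrite exchange_big mulr_sumr; apply: eq_bigr => E _ /=.
have [->|/wU[EU cE]] := eqVneq (w E) 0.
  by rewrite mulr0 big1// => T _; case: ifP.
rewrite -big_mkcondr sumr_const mulr_natl -cE.
congr (_ *+ _); apply: eq_card => v; rewrite [LHS]unfold_in finset.sub1set.
by apply/andP/idP => [[]//|vE]; rewrite (fintype.subsetP EU).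
Qed.

(** As [r >= 2], the degrees sum to at least [rho * #|U|]. Light vertices account for at most half
    of this, and each heavy one for at most [K * rho]. *)
Lemma card_heavy_vertices U r w (rho K : R) : uniform_weight U r w ->
  (2 <= r)%N -> 0 < rho -> 0 < K ->
  (forall v, codegree w [set v] <= K * rho) ->
  rho * #|U|%:R / 2 <= total_weight w ->
  #|U|%:R / (2 * K) <= #|[set v in U | rho / 2 <= codegree w [set v]]|%:R :> R.
Proof.
move=> wU r2 rho0 K0 wK tw; set X := [set v in U | _].
have XU : X \subset U by apply/fintype.subsetP => v; rewrite inE => /andP[].
have : rho * #|U|%:R <= r%:R * total_weight w.
  apply: (@le_trans _ _ (2 * total_weight w)); first lra.
  rewrite ler_wpM2r ?ler_nat//; move: wU => [w0 _]; exact: sumr_ge0.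
rewrite -(sum_vertex_degree wU) (bigID (mem X)) /= => h.
have h1 : \sum_(v in U | v \in X) codegree w [set v] <= #|X|%:R * (K * rho).
  rewrite mulr_natl -sumr_const big_mkcond [leRHS]big_mkcond /=.
  apply: ler_sum => v _; case: (boolP (v \in X)) => [vX|]; rewrite ?andbF//.
  by rewrite (fintype.subsetP XU) //=; apply: wK.
have h2 : \sum_(v in U | v \notin X) codegree w [set v] <= #|U|%:R * (rho / 2).
  rewrite mulr_natl -sumr_const big_mkcond [leRHS]big_mkcond /=.
  apply: ler_sum => v _; case: (boolP (v \in U)) => //= vU.
  rewrite inE vU /= -ltNge; case: ifP => [/ltW//|_].
  by rewrite divr_ge0// ltW.
have {h h1 h2} h : rho * (#|U|%:R / 2) <= rho * (#|X|%:R * K) by lra.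
rewrite ler_pM2l// in h.
by rewrite invfM mulrA ler_pdivrMr.
Qed.

End Weights.

(** * Discarding the edges over sets of large codegree *)

Section Pruning.
Variables (R : realType) (V : finType).
Implicit Types (U T E I : {set V}) (w a g : {set V} -> R) (v : V).

(** The threshold is the balance condition at density [t * rho], which [g] reaches after [t * #|U|]
    links of weight about [rho]. The empty set is left out because its codegree is the total
    weight. *)
Definition saturated g (kappa t rho : R) T : bool :=
  (T != finset.set0) && (kappa * t ^+ #|T| * rho < codegree g T).

(** Zeroing these weights keeps further links from adding to the codegree of a saturated set. *)
Definition prune w g (kappa t rho : R) : {set V} -> R := fun E =>
  if [exists T : {set V}, saturated g kappa t rho T && (T \subset E)] then 0 else w E.

Lemma prune_le w g kappa t rho E : 0 <= w E -> 0 <= prune w g kappa t rho E <= w E.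
Proof. by move=> w0; rewrite /prune; case: ifP; rewrite w0 lexx. Qed.

Lemma uniform_prune U r w g kappa t rho :
  uniform_weight U r w -> uniform_weight U r (prune w g kappa t rho).
Proof.
move=> [w0 wU]; split=> E; first by case/andP: (prune_le g kappa t rho (w0 E)).
by rewrite /prune; case: ifP; rewrite ?eqxx// => _ /wU.
Qed.

Lemma codegree_prune_saturated w g kappa t rho T E :
  saturated g kappa t rho T -> T \subset E ->
  codegree (prune w g kappa t rho) E = 0.
Proof.
move=> sT TE; apply: big1 => E' EE'; rewrite /prune.
case: existsP => // -[]; exists T.
by rewrite sT (fintype.subset_trans TE).
Qed.

(** Few sets are saturated, since the codegrees of [g] sum to only [2 ^ r] times its total weight;
    hence pruning loses at most half of the guaranteed weight [rho * #|U|]. *)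
Lemma total_weight_prune U r w g (kappa K t rho : R) m :
  0 < t -> 0 < rho -> 0 < K ->
  (forall E, 0 <= w E) ->
  (forall T, T != finset.set0 -> codegree w T <= K * t ^+ #|T|.-1 * rho) ->
  uniform_weight U r g -> total_weight g <= m * K * rho ->
  rho * #|U|%:R <= total_weight w -> t * #|U|%:R = m ->
  kappa = 2 ^+ r.+1 * K ^+ 2 ->
  rho * #|U|%:R / 2 <= total_weight (prune w g kappa t rho).
Proof.
move=> t0 rho0 K0 w0 wK gU gm tw tm kappaE.
have kappa0 : 0 < kappa by rewrite kappaE mulr_gt0 ?exprn_gt0.
set a := prune _ _ _ _ _; set sat := saturated g kappa t rho.
suff : total_weight w - total_weight a <= rho * #|U|%:R / 2 by lra.
(* Every pruned edge contains a saturated set and is charged to it. *)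
apply: (@le_trans _ _ (\sum_(T | sat T) codegree w T)).
  rewrite /total_weight -sumrB /codegree.
  under [leRHS]eq_bigr do rewrite big_mkcond.
  rewrite exchange_big /=; apply: ler_sum => E _.
  have s0 T : 0 <= (if T \subset E then w E else 0) by case: ifP.
  rewrite /a /prune; case: existsP => [[T /andP[sT TE]]|_]; last first.
    by rewrite subrr sumr_ge0.
  by rewrite subr0 (bigD1 T)//= TE lerDl sumr_ge0.
apply: (@le_trans _ _ (K / (kappa * t) * \sum_T codegree g T)).
  rewrite mulr_sumr [leLHS]big_mkcond /=; apply: ler_sum => T _.
  have c0 : 0 <= K / (kappa * t) by rewrite divr_ge0 ?mulr_ge0 ?ltW.
  case: ifP => [/andP[T0 sT]|_]; last first.
    by rewrite mulr_ge0// codegree_ge0//; case: gU.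
  apply: le_trans (wK _ T0) _.
  apply: le_trans (ler_wpM2l c0 (ltW sT)).
  have cT : (0 < #|T|)%N by rewrite card_gt0.
  rewrite -[in leRHS](prednK cT) exprS le_eqVlt; apply/orP; left; apply/eqP.
  by field; rewrite !gt_eqF.
rewrite (sum_codegree gU).
have c0 : 0 <= K / (kappa * t) by rewrite divr_ge0 ?mulr_ge0 ?ltW.
have {}gm := ler_wpM2l c0 (ler_wpM2l (ler0n R (2 ^ r)) gm).
(* [kappa] is chosen to make [2 ^ r * K ^ 2 / kappa] equal to 1/2. *)
apply: le_trans gm _; rewrite -tm kappaE natrX exprS le_eqVlt.
apply/orP; left; apply/eqP; field.
by rewrite !gt_eqF ?exprn_gt0.
Qed.

End Pruning.

(** * Families of containers and the state of the vertex-by-vertex construction *)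

Section Containers.
Variables (R : realType) (V : finType).
Implicit Types (U T E I C X : {set V}) (w a g : {set V} -> R) (v : V).

Definition has_containers U (delta b : R) (P : {set V} -> Prop) : Prop :=
  exists CC : {set {set V}}, [/\ #|CC|%:R <= b,
    forall C, C \in CC -> C \subset U /\ #|C|%:R <= (1 - delta) * #|U|%:R
  & forall I, I \subset U -> P I -> exists2 C, C \in CC & I \subset C].

Lemma has_containers1 U (delta : R) C (P : {set V} -> Prop) :
  C \subset U -> #|C|%:R <= (1 - delta) * #|U|%:R ->
  (forall I, I \subset U -> P I -> I \subset C) -> has_containers U delta 1 P.
Proof.
move=> CU cC IC; exists [set C]; split; first by rewrite cards1.
  by move=> D; rewrite inE => /eqP ->.
by move=> I IU /(IC _ IU) h; exists C => //; rewrite set11.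
Qed.

(** A set that avoids [X] lies in [U :\: X]; any other is handled by one of its vertices in [X]. The
    count is [1 + #|X| * b], and [1 <= b] absorbs the 1. *)
Lemma has_containers_split U (delta b : R) X (P : {set V} -> Prop)
    (Q : V -> {set V} -> Prop) :
  1 <= b -> X \subset U -> delta * #|U|%:R <= #|X|%:R ->
  (forall v, v \in X -> has_containers U delta b (Q v)) ->
  (forall v I, v \in X -> v \in I -> P I -> Q v I) ->
  has_containers U delta ((#|U| + 1)%:R * b) P.
Proof.
move=> b1 XU cX Qc PQ.
have /choice[F FP] v : exists CC : {set {set V}}, v \in X ->
    [/\ #|CC|%:R <= b,
    forall C, C \in CC -> C \subset U /\ #|C|%:R <= (1 - delta) * #|U|%:R
  & forall I, I \subset U -> Q v I -> exists2 C, C \in CC & I \subset C].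
  case: (boolP (v \in X)) => [/Qc[CC CCP]|_]; last by exists finset.set0.
  by exists CC.
exists ((U :\: X) |: \bigcup_(v in X) F v); split.
- rewrite natrD mulrDl mul1r addrC cardsU1 natrD; apply: lerD.
    by apply: le_trans b1; rewrite lern1 leq_b1.
  apply: (@le_trans _ _ (\sum_(v in X) #|F v|)%:R).
    by rewrite ler_nat leq_card_bigcup.
  rewrite natr_sum; apply: (@le_trans _ _ (\sum_(v in X) b)).
    by apply: ler_sum => v vX; case: (FP v vX).
  rewrite sumr_const -[leLHS]mulr_natl ler_wpM2r ?(le_trans ler01)//.
  by rewrite ler_nat subset_leq_card.
- move=> C; rewrite !inE => /orP[/eqP ->|/bigcupP[v vX]]; last first.
    by case: (FP v vX) => _ h _ /h.
  split; first exact: finset.subsetDl.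
  by rewrite cardsDS// natrB ?subset_leq_card//; lra.
move=> I IU PI; have [/fintype.existsP[v /andP[vX vI]]|nX] :=
    boolP [exists v, (v \in X) && (v \in I)].
  have [_ _ /(_ I IU (PQ _ _ vX vI PI))[C CF IC]] := FP v vX.
  by exists C => //; rewrite !inE; apply/orP; right; apply/bigcupP; exists v.
exists (U :\: X); first by rewrite !inE eqxx.
apply/fintype.subsetP => v vI; rewrite inE (fintype.subsetP IU)// andbT.
by apply: contra nX => vX; apply/fintype.existsP; exists v; rewrite vX.
Qed.

Lemma has_containers_le U (delta delta' b b' : R) (P P' : {set V} -> Prop) :
  delta' <= delta -> b <= b' -> (forall I, P' I -> P I) ->
  has_containers U delta b P -> has_containers U delta' b' P'.
Proof.
move=> dd bb PP [CC [h1 h2 h3]]; exists CC; split; first exact: le_trans bb.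
- move=> C /h2[CU cC]; split => //; apply: le_trans cC _.
  by rewrite ler_wpM2r// lerD2l lerN2.
by move=> I IU /PP /(h3 _ IU).
Qed.

Lemma uniform_link U r w v : uniform_weight U r.+1 w -> uniform_weight U r (link w v).
Proof.
move=> [w0 wU]; split=> E; rewrite /link; case: ifP => // vE.
  by rewrite eqxx.
move=> /wU[vEU]; rewrite cardsU1 vE add1n => -[->]; split=> //.
exact: fintype.subset_trans (finset.subsetUr _ _) vEU.
Qed.

Lemma uniformD U r w a : uniform_weight U r w -> uniform_weight U r a ->
  uniform_weight U r (fun E => w E + a E).
Proof.
move=> [w0 wU] [a0 aU]; split=> E; first exact: addr_ge0.
by have [->|/wU//] := eqVneq (w E) 0; rewrite add0r => /aU.
Qed.

(* [g] is the part of the link hypergraph collected after choosing [s] vertices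
   of the independent set. *)
Definition container_state U r (w g : {set V} -> R) (kappa K t rho : R) (s : nat) : Prop :=
  [/\ uniform_weight U r g,
      s%:R * (rho / 2) <= total_weight g,
      total_weight g <= s%:R * K * rho
    & forall T, T != finset.set0 -> codegree g T <= (kappa + K) * t ^+ #|T| * rho].

(** The new link adds nothing to the codegree of [T] if [v] is in [T] or [T] is saturated. Otherwise
    the old codegree is at most [kappa * t ^+ #|T| * rho], and the link adds at most the codegree of
    [v |: T] in [w]. *)
Lemma container_state_step U r w g (kappa K t rho : R) s v :
  0 < t -> 0 < rho -> 0 < K -> 0 < kappa ->
  uniform_weight U r.+1 w ->
  (forall T, T != finset.set0 -> codegree w T <= K * t ^+ #|T|.-1 * rho) ->
  container_state U r w g kappa K t rho s ->
  rho / 2 <= codegree (prune w g kappa t rho) [set v] ->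
  container_state U r w
    (fun E => g E + link (prune w g kappa t rho) v E) kappa K t rho s.+1.
Proof.
move=> t0 rho0 K0 kappa0 wU wK [gU g1 g2 g3]; set a := prune _ _ _ _ _ => av.
have [w0 _] := wU.
have aw E : a E <= w E by case/andP: (prune_le g kappa t rho (w0 E)).
have twD : total_weight (fun E => g E + link a v E)
    = total_weight g + codegree a [set v].
  by rewrite -total_weight_link -big_split.
have s1 : [set v] != finset.set0 by rewrite -card_gt0 cards1.
have aK : codegree a [set v] <= K * rho.
  apply: le_trans (codegree_le _ aw) _.
  by apply: le_trans (wK _ s1) _; rewrite cards1 mulr1.
split.
- by apply: uniformD => //; apply: uniform_link; apply: uniform_prune.
- by rewrite twD -[s.+1]addn1 natrD mulrDl mul1r lerD.
- by rewrite twD -[s.+1]addn1 natrD !mulrDl mul1r lerD.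
move=> T T0; rewrite codegreeD.
have p0 : 0 <= K * t ^+ #|T| * rho by rewrite !mulr_ge0 ?exprn_ge0 ?ltW.
have [vT|vT] := boolP (v \in T).
  by rewrite codegree_link_in// addr0 g3.
rewrite codegree_link_notin//.
have [sT|] := boolP (saturated g kappa t rho T).
  by rewrite (codegree_prune_saturated _ sT) ?finset.subsetUr// addr0 g3.
rewrite /saturated T0 /= -leNgt => hT.
have : codegree a (v |: T) <= K * t ^+ #|T| * rho.
  apply: le_trans (codegree_le _ aw) _.
  have vT0 : v |: T != finset.set0 by rewrite -card_gt0 cardsU1 vT.
  by apply: le_trans (wK _ vT0) _; rewrite cardsU1 vT.
by rewrite !mulrDl; lra.
Qed.

(** An edge of the link inside [I], together with [v], would be an edge of [w] inside [I]. *)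
Lemma independent_step w g (kappa t rho : R) v I :
  (forall E, 0 <= w E) ->
  v \in I -> independent w I -> independent g I ->
  independent (fun E => g E + link (prune w g kappa t rho) v E) I.
Proof.
move=> w0 vI wI gI E; have [gE|/gI//] := eqVneq (g E) 0.
rewrite gE add0r /link; case: ifP => vE; first by rewrite eqxx.
move=> aE; have : w (v |: E) != 0.
  by apply: contra aE => /eqP w0'; rewrite /prune w0' if_same.
move=> /wI; apply: contra => EI.
by rewrite finset.subUset finset.sub1set vI.
Qed.

End Containers.

(** [rho] is the density and [t] the decay rate of the codegrees. Each of the [r] levels of the
    induction chooses at most [m] vertices, and each choice costs a factor [#|U| + 1]. *)
Lemma container_lemma (R : realType) (r : nat) (K : R) : 0 < K ->
  exists2 delta : R, 0 < delta &
  forall (V : finType) (U : {set V}) (w : {set V} -> R) (t rho : R) (m : nat),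
  0 < t -> 0 < rho -> t * #|U|%:R = m%:R ->
  uniform_weight U r.+1 w ->
  rho * #|U|%:R <= total_weight w ->
  (forall T, T != finset.set0 -> codegree w T <= K * t ^+ #|T|.-1 * rho) ->
  has_containers U delta ((#|U| + 1)%:R ^+ (r * m)) (independent w).
Proof.
elim: r K => [|r IH] K K0.
  (* In the 1-uniform case an independent set avoids all vertices of non-zero weight, of which there
     are at least [#|U| / K]. *)
  exists K^-1; first by rewrite invr_gt0.
  move=> V U w t rho m t0 rho0 tm wU tw wK.
  pose X := [set v | w [set v] != 0].
  have [w0 wU1] := wU.
  have XU : X \subset U.
    by apply/fintype.subsetP => v; rewrite inE => /wU1[]; rewrite finset.sub1set.
  have cX : #|U|%:R / K <= #|X|%:R.
    have twX : total_weight w <= #|X|%:R * (K * rho).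
      have := sum_vertex_degree wU; rewrite mul1r => <-.
      have c0 v : v \in U -> v \notin X -> codegree w [set v] = 0.
        move=> vU; rewrite inE negbK => /eqP wv; apply: big1 => E.
        have [->//|/wU1[EU /eqP/cards1P[x ->]]] := eqVneq (w E) 0.
        by rewrite finset.sub1set inE => /eqP <-.
      rewrite mulr_natl -sumr_const big_mkcond [leRHS]big_mkcond.
      apply: ler_sum => v _; case: ifP => vU; last first.
        by case: ifP => // _; rewrite ltW// mulr_gt0.
      case: (boolP (v \in X)) => [vX|/(c0 _ vU) ->//].
      have v0 : [set v] != finset.set0 by rewrite -card_gt0 cards1.
      by apply: le_trans (wK _ v0) _; rewrite cards1 mulr1.
    rewrite ler_pdivrMr// -(ler_pM2l rho0).
    by apply: le_trans tw _; apply: le_trans twX _; rewrite le_eqVlt; apply/orP; left; apply/eqP; ring.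
  apply: (@has_containers1 _ _ _ _ (U :\: X)); first exact: finset.subsetDl.
    rewrite cardsDS// natrB ?subset_leq_card// mulrBl mul1r lerD2l lerN2.
    by rewrite mulrC.
  move=> I IU wI; apply/fintype.subsetP => v vI.
  rewrite !inE negbK (fintype.subsetP IU)// andbT; apply/negPn/negP => /wI.
  by rewrite finset.sub1set vI.
pose kappa := 2 ^+ r.+2 * K ^+ 2.
have kappa0 : 0 < kappa by rewrite mulr_gt0 ?exprn_gt0.
(* After [m] steps [g] has density at least [t * rho / 2] and codegrees at most
   [(kappa + K) * t ^+ #|T| * rho], so it is balanced with constant [2 * (kappa + K)]. *)
have K'0 : 0 < 2 * (kappa + K) by rewrite mulr_gt0 ?addr_gt0.
have [delta' delta'0 {}IH] := IH _ K'0.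
(* [delta'] serves runs that complete [m] steps; [(2 * K)^-1] is the proportion of heavy vertices
   removed when a run stops earlier. *)
exists (Num.min delta' (2 * K)^-1).
  by rewrite lt_min delta'0 invr_gt0 mulr_gt0.
move=> V U w t rho m t0 rho0 tm wU tw wK.
set delta := Num.min _ _.
have [w0 _] := wU.
pose n1 : R := (#|U| + 1)%:R.
have n1_ge1 : 1 <= n1 by rewrite /n1 ler1n addn1.
(* [s] steps are done and [k] remain; [r * m] is the cost of the recursive call on the final [g]. *)
suff main k s g : (s + k = m)%N -> container_state U r.+1 w g kappa K t rho s ->
    has_containers U delta (n1 ^+ (k + r * m))
      (fun I => independent w I /\ independent g I).
  pose g0 : {set V} -> R := fun=> 0.
  have codeg0 T : codegree g0 T = 0 by apply: big1.
  have tw0 : total_weight g0 = 0 by apply: big1.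
  have := main m 0%N g0 (add0n _) _.
  rewrite mulSn => h; apply: has_containers_le (lexx _) (lexx _) _ (h _).
    by move=> I wI; split=> // E; rewrite eqxx.
  split; rewrite ?tw0 ?mul0r//; first by split=> // E; rewrite eqxx.
  by move=> T _; rewrite codeg0 !mulr_ge0 ?exprn_ge0 ?addr_ge0 ?ltW.
elim: k s g => [|k IHk] s g.
  rewrite addn0 => -> [gU g1 _ g3]; rewrite add0n.
  apply: (@has_containers_le _ _ _ delta' _ (n1 ^+ (r * m)) _ (independent g)) => //.
  - by rewrite ge_min lexx.
  - by move=> I [].
  apply: (IH _ U g t (t * rho / 2)) => //.
  - by rewrite divr_gt0 ?mulr_gt0.
  - by apply: le_trans g1; rewrite -tm le_eqVlt; apply/orP; left; apply/eqP; ring.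
  move=> T T0; apply: le_trans (g3 _ T0) _.
  have cT : (0 < #|T|)%N by rewrite card_gt0.
  rewrite -[in leLHS](prednK cT) exprS le_eqVlt; apply/orP; left; apply/eqP.
  by field.
move=> skm st; have [gU g1 g2 g3] := st.
set a := prune w g kappa t rho.
have aU : uniform_weight U r.+2 a by apply: uniform_prune.
have [a0 _] := aU.
have smR : s%:R <= m%:R :> R by rewrite ler_nat -skm leq_addr.
have ta : rho * #|U|%:R / 2 <= total_weight a.
  apply: (@total_weight_prune _ _ U r.+1 w g kappa K t rho m%:R) => //.
  by apply: le_trans g2 _; rewrite -!mulrA ler_wpM2r// mulr_ge0 ?ltW.
have aK v : codegree a [set v] <= K * rho.
  have v0 : [set v] != finset.set0 by rewrite -card_gt0 cards1.
  apply: le_trans (codegree_le _ _) _; last first.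
    by apply: le_trans (wK _ v0) _; rewrite cards1 mulr1.
  by move=> E; case/andP: (prune_le g kappa t rho (w0 E)).
have cX := card_heavy_vertices aU isT rho0 K0 aK ta.
set X := [set v in U | _] in cX.
have -> : n1 ^+ (k.+1 + r * m) = (#|U| + 1)%:R * n1 ^+ (k + r * m).
  by rewrite addSn exprS.
apply: (@has_containers_split _ _ _ _ _ X _ (fun v I => independent w I /\
  independent (fun E => g E + link a v E) I)).
- by rewrite exprn_ege1.
- by apply/fintype.subsetP => v; rewrite inE => /andP[].
- apply: le_trans cX; rewrite [leRHS]mulrC ler_wpM2r//.
  by rewrite ge_min lexx orbT.
- move=> v; rewrite inE => /andP[vU av].
  by apply: (IHk s.+1); [rewrite addSnnS|exact: container_state_step].
- move=> v I _ vI [wI gI]; split => //; exact: independent_step.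
Qed.

(** Each round multiplies the number of containers by at most [b] and their sizes by [1 - delta];
    pieces already smaller than [L] are kept, whence the disjunction. *)
Lemma iterated_containers (R : realType) (V : finType) (delta b L : R)
    (P : {set V} -> Prop) : delta <= 1 -> 1 <= b ->
  (forall U : {set V}, L <= #|U|%:R -> has_containers U delta b P) ->
  forall k (U : {set V}), exists CC : {set {set V}}, [/\ #|CC|%:R <= b ^+ k,
    forall C : {set V}, C \in CC -> #|C|%:R <= L \/ #|C|%:R <= (1 - delta) ^+ k * #|U|%:R
  & forall I : {set V}, I \subset U -> P I -> exists2 C, C \in CC & I \subset C].
Proof.
move=> d1 b1 cont; elim=> [|k IH] U.
  exists [set U]; split; first by rewrite cards1.
    by move=> C; rewrite inE => /eqP ->; right; rewrite mul1r.
  by move=> I IU _; exists U => //; rewrite set11.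
have [UL|LU] := ltP #|U|%:R L.
  exists [set U]; split; first by rewrite cards1 exprn_ege1.
    by move=> C; rewrite inE => /eqP ->; left; apply: ltW.
  by move=> I IU _; exists U => //; rewrite set11.
have [DD [cDD DDU DDI]] := cont U LU.
have /choice[F FP] := IH.
exists (\bigcup_(D in DD) F D); split.
- apply: (@le_trans _ _ (\sum_(D in DD) #|F D|)%:R).
    by rewrite ler_nat leq_card_bigcup.
  rewrite natr_sum; apply: (@le_trans _ _ (\sum_(D in DD) b ^+ k)).
    by apply: ler_sum => D _; case: (FP D).
  by rewrite sumr_const -[leLHS]mulr_natl exprS ler_wpM2r// exprn_ge0// (le_trans ler01).
- move=> C /bigcupP[D DD_D CF]; have [_ /(_ _ CF)[cC|cC] _] := FP D; [by left|right].
  apply: le_trans cC _; rewrite exprSr -mulrA ler_wpM2l ?exprn_ge0 ?subr_ge0//.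
  by case: (DDU D DD_D).
move=> I IU PI; have [D DD_D ID] := DDI I IU PI.
have [_ _ /(_ I ID PI)[C CF IC]] := FP D.
by exists C => //; apply/bigcupP; exists D.
Qed.

(** Such an [S] lies only in an edge equal to it. This covers sets of size [d.+1], for which
    balanced supersaturation gives no codegree bound. *)
Lemma card_supersets_gt (V : finType) (H : {set {set V}}) r (S : {set V}) :
  (forall E, E \in H -> #|E| = r) -> (r <= #|S|)%N ->
  (#|[set E in H | S \subset E]| <= 1)%N.
Proof.
move=> Hr rS; apply/card_le1P => E; rewrite inE => /andP[EH SE] E'.
rewrite !inE; apply/idP/eqP => [/andP[E'H SE']|->]; last by rewrite EH.
have Q D : D \in H -> S \subset D -> D = S.
  by move=> DH SD; apply/esym/eqP; rewrite eqEcard SD Hr.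
by rewrite (Q E')// (Q E).
Qed.

(** [container_lemma] is applied to the indicator of [H] with [t = m / #|U|] and
    [rho = c * #|U| ^ d / q]. The factor [q ^ ((i - 1) / d)] in the codegree bound is absorbed by
    [m ^ (i - 1)], as [m >= q ^ (1 / d)]. *)
Lemma supersaturated_containers (R : realType) (d : nat) (c C' : R) :
  (0 < d)%N -> 0 < c -> 0 < C' ->
  exists2 delta : R, 0 < delta <= 2^-1 &
  forall (F : finFieldType) (q m : nat) (U : {set 'rV[F]_d}) (H : {set {set 'rV[F]_d}}),
  (0 < q)%N -> q%:R `^ d%:R^-1 <= m%:R :> R -> (0 < #|U|)%N ->
  H \subset degenerate_sets U ->
  c * #|U|%:R ^+ d.+1 / q%:R <= #|H|%:R ->
  (forall i : nat, (1 <= i <= d)%N ->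
          (max_degree U H i)%:R <=
            C' * #|U|%:R ^+ (d.+1 - i)%N / q%:R `^ (1 - (i%:R - 1) / d%:R)) ->
  has_containers U delta ((#|U| + 1)%:R ^+ (d * m)) (fun I => general_position I).
Proof.
move=> d0 c0 C'0; have C10 : 0 < C' + 1 by rewrite addr_gt0.
(* In [K = (C' + 1) / c] the division cancels the [c] in [rho], and the added 1 covers sets of size
   [d.+1], of codegree at most 1. *)
have [delta delta0 contP] := container_lemma d (divr_gt0 C10 c0).
exists (Num.min delta 2^-1).
  by rewrite lt_min delta0 invr_gt0 ltr0n ge_min lexx orbT.
move=> F q m U H q0 qm U0 Hdeg cH degH.
pose n : R := #|U|%:R; have n0 : 0 < n by rewrite ltr0n.
have qR0 : 0 < q%:R :> R by rewrite ltr0n.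
have x0 : 0 < q%:R `^ d%:R^-1 :> R by rewrite powR_gt0.
have m0 : 0 < m%:R :> R by apply: lt_le_trans qm.
have HE E : E \in H -> E \subset U /\ #|E| = d.+1.
  by move/(fintype.subsetP Hdeg); rewrite inE => /and3P[? /eqP].
pose w E : R := (E \in H)%:R.
have codegE T : codegree w T = #|[set E in H | T \subset E]|%:R.
  rewrite /codegree /w -natr_sum; congr (_%:R).
  rewrite -sum1_card big_mkcond [RHS]big_mkcond.
  by apply: eq_bigr => E _; rewrite inE; case: (E \in H); case: (T \subset E).
apply: (@has_containers_le _ _ _ delta _ ((#|U| + 1)%:R ^+ (d * m)) _ (independent w)) => //.
- by rewrite ge_min lexx.
- move=> I GI E; rewrite /w pnatr_eq0 eqb0 negbK => EH; apply/negP => EI.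
  have := fintype.forallP GI E; have := fintype.subsetP Hdeg _ EH.
  by rewrite inE => /and3P[_ cE ->]; rewrite EI cE.
apply: (contP _ U w (m%:R / n) (c * n ^+ d / q%:R)).
- exact: divr_gt0.
- by rewrite divr_gt0// mulr_gt0// exprn_gt0.
- by rewrite divfK// gt_eqF.
- split=> E; first by rewrite ler0n.
  by rewrite /w pnatr_eq0 eqb0 negbK => /HE.
- apply: le_trans (_ : #|H|%:R <= _); last first.
    rewrite /total_weight /w -natr_sum ler_nat -sum1_card big_mkcond /=.
    by apply: leq_sum => E _; case: (E \in H).
  apply: le_trans cH; rewrite exprSr le_eqVlt; apply/orP; left; apply/eqP.
  by rewrite -/n; ring.
move=> T T0; rewrite codegE.
have rhs0 : 0 <= (C' + 1) / c * (m%:R / n) ^+ #|T|.-1 * (c * n ^+ d / q%:R).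
  by rewrite !mulr_ge0 ?exprn_ge0 ?invr_ge0 ?mulr_ge0 ?ltW ?invr_gt0.
(* A [T] in no edge satisfies the bound trivially; any other lies in [U] and has at most [d.+1]
   elements. *)
have [/eqP ->//|] := boolP (#|[set E in H | T \subset E]| == 0%N).
rewrite -lt0n card_gt0 => /finset.set0Pn[E]; rewrite inE => /andP[/HE[EU cE] TE].
have cT : (#|T| <= d.+1)%N by rewrite -cE subset_leq_card.
have TU := fintype.subset_trans TE EU.
have cT0 : (0 < #|T|)%N by rewrite card_gt0.
set i := #|T|.-1; have iE : #|T| = i.+1 by rewrite prednK.
have rhsE : (C' + 1) / c * (m%:R / n) ^+ i * (c * n ^+ d / q%:R)
    = (C' + 1) * (m%:R ^+ i * (n ^+ d / n ^+ i)) / q%:R.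
  rewrite exprMn exprVn; move: (_ ^+ i) (_ ^+ i)^-1 (n ^+ d) (q%:R^-1) => e1 e2 e3 e4.
  by field; rewrite gt_eqF.
set x := q%:R `^ d%:R^-1 in qm x0.
have mx k : x ^+ k <= m%:R ^+ k by rewrite lerXn2r// nnegrE ltW.
rewrite rhsE; have [id|di] := ltnP i d.
  have /degH h : (1 <= #|T| <= d)%N by rewrite cT0 iE.
  apply: (@le_trans _ _ (max_degree U H #|T|)%:R).
    rewrite ler_nat.
    apply: (leq_bigmax_cond (F := fun S : {set 'rV[F]_d} => degree H S)).
    by rewrite TU eqxx.
  apply: le_trans h _; rewrite iE subSS -natr1 addrK.
  have -> : q%:R `^ (1 - i%:R / d%:R) = q%:R / x ^+ i.
    rewrite powRD; last by rewrite (gt_eqF qR0) implybT.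
    by rewrite powRr1 ?ler0n// powRN [i%:R / _]mulrC powRrM powR_mulrn ?powR_ge0.
  have -> : n ^+ d / n ^+ i = n ^+ (d - i).
    by rewrite -[in n ^+ d](subnK (ltnW id)) exprD mulfK// gt_eqF ?exprn_gt0.
  rewrite -/n; set N := n ^+ (d - i).
  have -> : C' * N / (q%:R / x ^+ i) = C' * x ^+ i * (N / q%:R).
    by rewrite invf_div; move: N (x ^+ i) (q%:R^-1) => *; ring.
  have -> : (C' + 1) * (m%:R ^+ i * N) / q%:R = (C' + 1) * m%:R ^+ i * (N / q%:R).
    by rewrite !mulrA.
  rewrite ler_wpM2r ?divr_ge0 ?exprn_ge0 ?(ltW n0)//.
  by rewrite ler_pM ?exprn_ge0 ?(ltW C'0) ?(ltW x0)// lerDl.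
(* Here [T] has full size [d.+1], and [m ^ d >= q] makes the right-hand side at least 1. *)
have id : i = d by apply/eqP; rewrite eqn_leq di andbT -ltnS -iE.
apply: (@le_trans _ _ 1).
  rewrite lern1 (card_supersets_gt (r := d.+1))//; last by rewrite iE id.
  by move=> E' /HE[].
rewrite ler_pdivlMr// mul1r id divff ?gt_eqF ?exprn_gt0// mulr1.
apply: (@le_trans _ _ (1 * m%:R ^+ d)).
  rewrite mul1r; apply: le_trans (mx d).
  rewrite /x -powR_mulrn ?powR_ge0// -powRrM mulVf ?powRr1 ?ler0n//.
  by rewrite pnatr_eq0 -lt0n.
by rewrite ler_wpM2r ?exprn_ge0 ?(ltW m0)// lerDr ltW.
Qed.

(** * Asymptotics *)

Local Open Scope classical_set_scope.
Local Open Scope ring_scope.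
Local Notation W := (within prime_power \oo).

Lemma prime_power_gt1 q : prime_power q -> (1 < q)%N.
Proof.
move=> [p [k [pp k0 ->]]]; rewrite -{1}(exp1n k) ltn_exp2r//.
exact: prime_gt1.
Qed.

Lemma card_affine_space q d : prime_power q -> #|{: 'rV[GF q]_d}| = (q ^ d)%N.
Proof. by move=> qq; rewrite card_mx mul1n card_GF. Qed.

Lemma near_prime_power (R : realType) (r : R) : \forall q \near W,
  [/\ prime_power q, (1 < q)%N & r <= q%:R].
Proof.
rewrite near_withinE; near=> q => qq; split => //; first exact: prime_power_gt1.
by near: q; apply: nbhs_infty_ger.
Unshelve. all: by end_near. Qed.

(** Starting from the whole space, about [d * ln q / delta] rounds shrink every container to size at
    most [T * q], as [(1 - delta) ^ k <= q ^ (- d)]. *)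
Lemma few_containers (R : realType) (d : nat) : (0 < d)%N ->
  balanced_supersaturation R d ->
  exists A T : R, [/\ 0 < A, 0 < T &
    \forall q \near W, exists CC : {set {set 'rV[GF q]_d}},
    [/\ #|CC|%:R <= expR (A * (q%:R `^ d%:R^-1 * ln q%:R ^+ 2)),
      forall C : {set 'rV[GF q]_d}, C \in CC -> #|C|%:R <= T * q%:R
    & forall I : {set 'rV[GF q]_d}, general_position I ->
        exists2 C : {set 'rV[GF q]_d}, C \in CC & I \subset C]].
Proof.
move=> d0 [T0 [c [C' [q0 [[T00 c0 C'0 _] BS]]]]].
have [delta /andP[delta0 delta1] contP] := supersaturated_containers d0 c0 C'0.
have dR : 0 < d%:R :> R by rewrite ltr0n.
pose B := d%:R / delta + 1 : R.
have B0 : 0 < B by rewrite addr_gt0 ?divr_gt0.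
(* The factors [d + 1], [d * 2] and [B] bound [ln (q ^ d + 1) / ln q], [d * m / q ^ (1 / d)] and
   [k / ln q]. The maximum with 1 leaves room for containers of size at most 1. *)
exists ((d%:R + 1) * (d%:R * 2 * B)), (Num.max T0 1).
have T1 : 1 <= Num.max T0 1 by rewrite le_max lexx orbT.
have AT0 : 0 < (d%:R + 1) * (d%:R * 2 * B).
  by apply: mulr_gt0; [exact: addr_gt0|apply: mulr_gt0 => //; exact: mulr_gt0].
split; [by []|exact: lt_le_trans T1|].
near=> q.
have [qq q1 qbig] : [/\ prime_power q, (1 < q)%N & Num.max q0 (expR 1) <= q%:R].
  by near: q; apply: near_prime_power.
move: qbig; rewrite ge_max => /andP[qq0 qe].
have qR0 : 0 < q%:R :> R by rewrite ltr0n ltnW.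
have qR1 : 1 <= q%:R :> R by rewrite ler1n ltnW.
have lq1 : 1 <= ln q%:R :> R by rewrite -[leLHS]expRK ler_ln ?posrE ?expR_gt0.
have lq0 : 0 < ln q%:R :> R by apply: lt_le_trans lq1.
set x : R := q%:R `^ d%:R^-1.
have x1 : 1 <= x.
  by rewrite -[leLHS](powRr0 q%:R) ler_powR// invr_ge0 ltW.
have nat_ceil (y : R) : 0 <= y -> exists m, y <= m%:R <= y + 1.
  move=> y0; exists (Num.trunc y).+1; rewrite ltW ?truncnS_gt//=.
  by rewrite -natr1 lerD2r truncn_le.
have [m /andP[xm mx]] := nat_ceil x (le_trans ler01 x1).
have y0 : 0 <= d%:R * ln q%:R / delta by rewrite divr_ge0 ?mulr_ge0 ?ltW.
have [k /andP[yk ky]] := nat_ceil _ y0.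
pose b : R := (q ^ d + 1)%:R ^+ (d * m).
have b1 : 1 <= b by rewrite exprn_ege1// ler1n addn1.
have cont (U : {set 'rV[GF q]_d}) : Num.max T0 1 * q%:R <= #|U|%:R ->
    has_containers U delta b (fun I => general_position I).
  move=> TU; have T0U : T0 * q%:R <= #|U|%:R.
    by apply: le_trans TU; rewrite ler_wpM2r ?(ltW qR0)// le_max lexx.
  have [H [Hdeg cH degH]] := BS q qq qq0 U T0U.
  have U0 : (0 < #|U|)%N.
    by rewrite -(ltr0n R); apply: lt_le_trans T0U; rewrite mulr_gt0.
  have := contP _ q m U H (ltnW q1) xm U0 Hdeg cH degH.
  apply: has_containers_le => //; rewrite lerXn2r ?nnegrE ?ler0n// ler_nat leq_add2r.
  by rewrite -(card_affine_space d qq) max_card.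
have d1 : delta <= 1 by lra.
have [CC [cCC CCs CCc]] := iterated_containers d1 b1 cont k [set: _]%SET.
exists CC; split.
- apply: le_trans cCC _; rewrite /b -exprM.
  have qd : (q ^ d + 1)%:R <= expR ((d%:R + 1) * ln q%:R) :> R.
    rewrite natr1 expRM_natl lnK ?posrE// -natrX ler_nat addn1.
    by rewrite ltn_exp2l.
  apply: (@le_trans _ _ (expR ((d%:R + 1) * ln q%:R) ^+ (d * m * k))).
    by rewrite lerXn2r ?nnegrE ?ler0n ?expR_ge0.
  rewrite -expRM_natr ler_expR !natrM.
  have m2 : m%:R <= 2 * x by lra.
  have kB : k%:R <= B * ln q%:R.
    apply: le_trans ky _; rewrite /B mulrDl mul1r lerD// le_eqVlt.
    by apply/orP; left; apply/eqP; rewrite mulrAC.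
  have E (a y l z : R) :
      (a + 1) * (a * 2 * z) * (y * l ^+ 2) = (a + 1) * l * (a * (2 * y) * (z * l)).
    by ring.
  rewrite E.
  rewrite ler_wpM2l ?mulr_ge0 ?addr_ge0 ?(ltW lq0)//.
  by rewrite ler_pM ?mulr_ge0// ler_wpM2l.
- move=> C /CCs[//|]; rewrite cardsT card_affine_space// natrX => cC.
  apply: le_trans cC _; apply: (@le_trans _ _ 1); last first.
    by rewrite -[leLHS]mulr1 ler_pM.
  have : (1 - delta) ^+ k <= expR (- (delta * k%:R)).
    rewrite -mulNr expRM_natr lerXn2r ?nnegrE ?expR_ge0 ?subr_ge0//.
    exact: expR_ge1Dx.
  move=> h; apply: (@le_trans _ _ (expR (- (delta * k%:R)) * expR (d%:R * ln q%:R))).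
    by rewrite expRM_natl lnK ?posrE// ler_wpM2r// exprn_ge0// ltW.
  rewrite -expRD -[leRHS]expR0 ler_expR addrC subr_le0.
  by move: yk; rewrite ler_pdivrMr// [_ * delta]mulrC.
by move=> I GI; apply: CCc GI; apply: finset.subsetT.
Unshelve. all: by end_near. Qed.

(** Phrased through failure probabilities, so that a lower and an upper bound combine by a union
    bound. *)
Definition whp (R : realType) (d : nat) (p : nat -> R)
    (P : forall q, pred {set 'rV[GF q]_d}) : Prop :=
  forall eps : R, 0 < eps ->
    \forall q \near W, random_subset_prob (p q) (predC (P q)) <= eps.

Definition unbounded (R : realType) (M : nat -> R) : Prop :=
  forall K : R, \forall q \near W, K <= M q.

(** * High-probability bounds on [alpha] *)

Section Asymptotics.
Variables (R : realType) (d : nat).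
Hypothesis d_gt0 : (0 < d)%N.
Implicit Types (p lo hi M : nat -> R).

Lemma whp_alpha_betweenI p lo hi : (forall q, prime_power q -> 0 <= p q <= 1) ->
  whp p (fun q => [pred A : {set 'rV[GF q]_d} | lo q <= (alpha A)%:R]) ->
  whp p (fun q => [pred A : {set 'rV[GF q]_d} | (alpha A)%:R <= hi q]) ->
  whp_alpha_between d p lo hi.
Proof.
move=> p01 wlo whi; apply/cvgrPdist_le => eps eps0.
have eps2 : 0 < eps / 2 by rewrite divr_gt0.
near=> q.
have [qq _ _] : [/\ prime_power q, (1 < q)%N & 0 <= q%:R :> R].
  by near: q; apply: near_prime_power.
rewrite random_subset_probC opprB addrC subrK.
rewrite ger0_norm ?random_subset_prob_ge0 ?p01//.
apply: le_trans (random_subset_probU (p01 _ qq) (P1 := predC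
   [pred A : {set 'rV[GF q]_d} | lo q <= (alpha A)%:R]) (P2 := predC
   [pred A : {set 'rV[GF q]_d} | (alpha A)%:R <= hi q]) _) _.
  by move=> A /=; rewrite negb_and.
rewrite [leRHS](splitr eps); apply: lerD; near: q; [exact: wlo|exact: whi].
Unshelve. all: by end_near. Qed.

Lemma whp_expR p M (P : forall q, pred {set 'rV[GF q]_d}) : unbounded M ->
  (\forall q \near W, random_subset_prob (p q) (predC (P q)) <= expR (- M q)) ->
  whp p P.
Proof.
move=> uM h eps eps0; near=> q.
apply: (@le_trans _ _ (expR (- M q))); first by near: q.
rewrite -[leRHS](lnK (eps0 : eps \in Num.pos)) ler_expR lerNl.
near: q; exact: uM.
Unshelve. all: by end_near. Qed.

(** If [alpha A > c * M], some container meets [A] in at least [c * M] points, while the mean is at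
    most [T * M]. Chernoff's bound beats the [expR (A0 * M)] containers and leaves [expR (- M)]. [M]
    stands for [p * q] in (b) and for [q ^ (1 / d) * ln q ^ 2] in (c). *)
Lemma whp_alpha_containers (A0 T c : R) p M : 0 < A0 -> 0 < T ->
  (\forall q \near W, exists CC : {set {set 'rV[GF q]_d}},
    [/\ #|CC|%:R <= expR (A0 * (q%:R `^ d%:R^-1 * ln q%:R ^+ 2)),
      forall C : {set 'rV[GF q]_d}, C \in CC -> #|C|%:R <= T * q%:R
    & forall I : {set 'rV[GF q]_d}, general_position I ->
        exists2 C : {set 'rV[GF q]_d}, C \in CC & I \subset C]) ->
  A0 + expR 1 * T + 1 <= c ->
  (forall q, prime_power q -> 0 <= p q <= 1) -> unbounded M ->
  (\forall q \near W, p q * q%:R <= M q) ->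
  (\forall q \near W, q%:R `^ d%:R^-1 * ln q%:R ^+ 2 <= M q) ->
  whp p (fun q => [pred A : {set 'rV[GF q]_d} | (alpha A)%:R <= c * M q]).
Proof.
move=> A00 T0 cont cc p01 uM pM LM; apply: (whp_expR uM); near=> q.
have [qq _ _] : [/\ prime_power q, (1 < q)%N & 0 <= q%:R :> R].
  by near: q; apply: near_prime_power.
have [CC [cCC CCs CCc]] : exists CC : {set {set 'rV[GF q]_d}},
    [/\ #|CC|%:R <= expR (A0 * (q%:R `^ d%:R^-1 * ln q%:R ^+ 2)),
      forall C : {set 'rV[GF q]_d}, C \in CC -> #|C|%:R <= T * q%:R
    & forall I : {set 'rV[GF q]_d}, general_position I ->
        exists2 C : {set 'rV[GF q]_d}, C \in CC & I \subset C].
  by near: q.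
have M0 : 0 <= M q by near: q; apply: uM.
have pMq : p q * q%:R <= M q by near: q.
have LMq : q%:R `^ d%:R^-1 * ln q%:R ^+ 2 <= M q by near: q.
have pq01 := p01 _ qq; have /andP[pq0 _] := pq01.
have e0 : 0 < expR 1 :> R := expR_gt0 _.
have := @random_subset_prob_bigcup R _ (p q) _ CC
  (fun C => [pred A : {set 'rV[GF q]_d} | c * M q <= #|A :&: C|%:R])
  (predC [pred A : {set 'rV[GF q]_d} | (alpha A)%:R <= c * M q])
  (expR (expR 1 * T * M q - c * M q)) pq01.
move=> h; apply: le_trans (h _ _) _.
- move=> A /=; rewrite -ltNge => cA.
  have [S [SA GS aS]] := alpha_witness A.
  have [C CCC SC] := CCc _ GS; exists C => //=.
  apply: le_trans (ltW cA) _; rewrite ler_nat -aS subset_leq_card//.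
  by rewrite finset.subsetI SA.
- move=> C /CCs cC; apply: le_trans (chernoff_upper _ _ pq01) _.
  rewrite ler_expR lerD2r -!mulrA ler_wpM2l ?(ltW e0)//.
  apply: (@le_trans _ _ (p q * (T * q%:R))); first by rewrite ler_wpM2l.
  by rewrite mulrCA ler_wpM2l// ltW.
apply: le_trans (ler_wpM2r (expR_ge0 _) cCC) _.
rewrite -expRD ler_expR.
have h1 : A0 * (q%:R `^ d%:R^-1 * ln q%:R ^+ 2) <= A0 * M q.
  by rewrite ler_wpM2l// ltW.
have h2 : (A0 + expR 1 * T + 1) * M q <= c * M q by rewrite ler_wpM2r.
by move: h2; rewrite !mulrDl mul1r; lra.
Unshelve. all: by end_near. Qed.

Lemma whp_alpha_le_card (c : R) p : expR 1 + 1 <= c ->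
  (forall q, prime_power q -> 0 <= p q <= 1) ->
  unbounded (fun q => p q * q%:R ^+ d) ->
  whp p (fun q => [pred A : {set 'rV[GF q]_d} | (alpha A)%:R <= c * p q * q%:R ^+ d]).
Proof.
move=> cc p01 uM; apply: (whp_expR uM); near=> q.
have [qq _ _] : [/\ prime_power q, (1 < q)%N & 0 <= q%:R :> R].
  by near: q; apply: near_prime_power.
have M0 : 0 <= p q * q%:R ^+ d by near: q; apply: uM.
have := @chernoff_upper R _ (p q) (c * p q * q%:R ^+ d) [set: 'rV[GF q]_d]%SET (p01 _ qq).
move=> h; apply: le_trans (random_subset_prob_le (p01 _ qq) _) (le_trans h _).
  move=> A; rewrite !inE -ltNge => cA; apply: le_trans (ltW cA) _.
  by rewrite finset.setIT ler_nat alpha_le_card.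
rewrite ler_expR cardsT card_affine_space// natrX.
by have := ler_wpM2r M0 cc; lra.
Unshelve. all: by end_near. Qed.

Lemma whp_alpha_ge_curve p :
  (forall q, prime_power q -> 0 <= p q <= 1) ->
  unbounded (fun q => p q * q%:R) ->
  whp p (fun q => [pred A : {set 'rV[GF q]_d} | 8^-1 * p q * q%:R <= (alpha A)%:R]).
Proof.
move=> p01 uM; have uM4 : unbounded (fun q => p q * q%:R / 4).
  move=> K; near=> q; rewrite ler_pdivlMr//; near: q; exact: uM.
apply: (whp_expR uM4); near=> q.
have [qq _ _] : [/\ prime_power q, (1 < q)%N & 0 <= q%:R :> R].
  by near: q; apply: near_prime_power.
have M0 : 0 <= p q * q%:R by near: q; apply: uM.
have := @chernoff_lower R _ (p q) (8^-1 * p q * q%:R) (moment_curve (GF q) d) (p01 _ qq).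
move=> h; apply: le_trans (random_subset_prob_le (p01 _ qq) _) (le_trans h _).
  move=> A; rewrite !inE -ltNge => cA; apply: le_trans (ltW cA).
  by rewrite ler_nat alpha_moment_curve.
by rewrite ler_expR card_moment_curve// card_GF//; lra.
Unshelve. all: by end_near. Qed.

(** With high probability [A] has more than [p * q ^ d / 4] points (Chernoff) and fewer than
    [p * q ^ d / 8] degenerate subsets (Markov); deletion leaves the difference. *)
Lemma whp_alpha_ge_deletion p :
  (\forall q \near W, 0 <= p q <= 1) ->
  unbounded (fun q => p q * q%:R ^+ d) ->
  (forall eta : R, 0 < eta -> \forall q \near W,
     p q <= eta * q%:R `^ (- d%:R + d%:R^-1)) ->
  whp p (fun q => [pred A : {set 'rV[GF q]_d} | 8^-1 * p q * q%:R ^+ d <= (alpha A)%:R]).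
Proof.
move=> p01 uM psmall eps eps0.
have eps2 : 0 < eps / 2 by rewrite divr_gt0.
have dR : 0 < d%:R :> R by rewrite ltr0n.
have uM4 : unbounded (fun q => p q * q%:R ^+ d / 4).
  move=> K; near=> q; rewrite ler_pdivlMr//; near: q; exact: uM.
(* The minimum with 1 gives [eta ^ d <= eta]; the other term makes the Markov bound [8 * d * eta] at
   most [eps / 2]. *)
pose eta : R := Num.min 1 (eps / 2 / (8 * d%:R)).
have eta0 : 0 < eta by rewrite lt_min ltr01 divr_gt0 ?mulr_gt0.
near=> q.
have [qq q1 _] : [/\ prime_power q, (1 < q)%N & 0 <= q%:R :> R].
  by near: q; apply: near_prime_power.
have qR0 : 0 < q%:R :> R by rewrite ltr0n ltnW.
have M1 : 1 <= p q * q%:R ^+ d by near: q; apply: uM.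
have M0 : 0 < p q * q%:R ^+ d by apply: lt_le_trans M1.
have pq01 : 0 <= p q <= 1 by near: q.
have /andP[pq0 _] := pq01.
have pe : p q <= eta * q%:R `^ (- d%:R + d%:R^-1) by near: q; apply: psmall.
pose D (A : {set 'rV[GF q]_d}) :=
  [set E in @degenerate_sets (GF q) d [set: _] | E \subset A].
apply: le_trans (random_subset_probU pq01
  (P1 := [pred A : {set 'rV[GF q]_d} | #|A :&: [set: _]|%:R <= p q * q%:R ^+ d / 4])
  (P2 := [pred A | p q * q%:R ^+ d / 8 <= #|D A|%:R]) _) _.
  move=> A; rewrite /= -ltNge => aA.
  have := alpha_deletion A; rewrite -(ler_nat R) natrD -/(D A) finset.setIT => h.
  by case: lerP => //= h1; lra.
rewrite [leRHS](splitr eps); apply: lerD.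
  apply: le_trans (chernoff_lower _ _ pq01) _.
  rewrite cardsT card_affine_space// natrX.
  have -> : p q * q%:R ^+ d / 4 - p q * q%:R ^+ d / 2 = - (p q * q%:R ^+ d / 4) by lra.
  rewrite -[leRHS](lnK (eps2 : eps / 2 \in Num.pos)) ler_expR lerNl.
  by near: q; apply: uM4.
apply: le_trans (markov_random_subset pq01 (h := p q * q%:R ^+ d / 8)
  (f := fun A => #|D A|%:R) _ _ _) _ => //.
  by rewrite divr_gt0.
rewrite (@expected_num_subsets _ _ _ _ d.+1); last first.
  by move=> E; rewrite inE => /and3P[_ /eqP].
rewrite ler_pdivrMr ?divr_gt0//.
apply: (@le_trans _ _ (d%:R * q%:R ^+ (d + d.-1 * d.+1) * p q ^+ d.+1)).
  rewrite ler_wpM2r ?exprn_ge0// -natrX -natrM ler_nat.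
  by have := @card_degenerate_sets (GF q) d d_gt0; rewrite card_GF.
have -> : d%:R * q%:R ^+ (d + d.-1 * d.+1) * p q ^+ d.+1
    = (d%:R * (q%:R ^+ (d.-1 * d.+1) * p q ^+ d)) * (p q * q%:R ^+ d).
  by rewrite exprD exprSr; move: (q%:R ^+ d) (_ ^+ (_ * _)) (p q ^+ d) => *; ring.
rewrite (_ : eps / 2 * _ = eps / 2 / 8 * (p q * q%:R ^+ d)); last first.
  by rewrite mulrA mulrAC.
rewrite ler_wpM2r ?(ltW M0)//.
have qp : q%:R ^+ (d.-1 * d.+1) * p q ^+ d <= eta ^+ d.
  set z := q%:R `^ _ in pe.
  (* The exponent [- d + 1 / d] is critical: its [d]-fold is [- (d - 1) * (d + 1)]. *)
  have zE : q%:R ^+ (d.-1 * d.+1) * z ^+ d = 1.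
    rewrite /z -!powR_mulrn ?powR_ge0 ?(ltW qR0)// -powRrM -powRD; last first.
      by rewrite (gt_eqF qR0) implybT.
    rewrite natrM -subn1 natrB// -[d.+1%:R]natr1 (_ : _ * _ + _ = 0) ?powRr0//.
    by field; rewrite gt_eqF.
  rewrite (_ : eta ^+ d = q%:R ^+ (d.-1 * d.+1) * (eta * z) ^+ d); last first.
    by rewrite exprMn mulrCA zE mulr1.
  rewrite ler_wpM2l ?exprn_ge0 ?(ltW qR0)//.
  by rewrite lerXn2r ?nnegrE// mulr_ge0 ?powR_ge0// ltW.
apply: (@le_trans _ _ (d%:R * eta)).
  rewrite ler_wpM2l//; apply: le_trans qp _.
  rewrite -[leRHS]expr1; apply: ler_wiXn2l => //; first exact: ltW.
  by rewrite ge_min lexx.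
have : eta <= eps / 2 / (8 * d%:R) by rewrite ge_min lexx orbT.
rewrite invfM mulrA ler_pdivlMr// mulrC => h.
by apply: le_trans h _; lra.
Unshelve. all: by end_near. Qed.

(** A lower bound on [alpha] is an increasing event, so its probability grows with [p]. *)
Lemma whp_alpha_ge_mono p p' lo lo' :
  (\forall q \near W, [/\ 0 <= p' q, p' q <= p q & p q <= 1]) ->
  (\forall q \near W, lo q <= lo' q) ->
  whp p' (fun q => [pred A : {set 'rV[GF q]_d} | lo' q <= (alpha A)%:R]) ->
  whp p (fun q => [pred A : {set 'rV[GF q]_d} | lo q <= (alpha A)%:R]).
Proof.
move=> pp ll h eps eps0; near=> q.
have [p'0 p'p p1] : [/\ 0 <= p' q, p' q <= p q & p q <= 1] by near: q.
have hq : random_subset_prob (p' q)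
  (predC [pred A : {set 'rV[GF q]_d} | lo' q <= (alpha A)%:R]) <= eps.
  by near: q; apply: h.
apply: le_trans hq.
have lq : lo q <= lo' q by near: q.
have p'01 : 0 <= p' q <= 1 by rewrite p'0 (le_trans p'p).
apply: (@le_trans _ _ (random_subset_prob (p' q)
  (predC [pred A : {set 'rV[GF q]_d} | lo q <= (alpha A)%:R]))); last first.
  apply: random_subset_prob_le => // B; rewrite !inE; apply: contra.
  exact: le_trans.
pose P := [pred A : {set 'rV[GF q]_d} | lo q <= (alpha A)%:R].
have Pup (A D : {set 'rV[GF q]_d}) : D \subset A -> P D -> P A.
  by move=> DA /= /le_trans; apply; rewrite ler_nat alpha_mono.
have := random_subset_prob_mono p'0 p'p p1 Pup.
rewrite (random_subset_probC (p' q)) (random_subset_probC (p q)).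
by rewrite lerD2l lerN2.
Unshelve. all: by end_near. Qed.

End Asymptotics.

(** * Growth of the comparison functions *)

Lemma unbounded_le (R : realType) (M M' : nat -> R) :
  (\forall q \near W, M q <= M' q) -> unbounded M -> unbounded M'.
Proof.
move=> MM uM K; near=> q; apply: (@le_trans _ _ (M q)); last by near: q.
by near: q; apply: uM.
Unshelve. all: by end_near. Qed.

Lemma unbounded_ln (R : realType) : unbounded (fun q => ln q%:R : R).
Proof.
move=> K; near=> q.
have [_ _ qK] : [/\ prime_power q, (1 < q)%N & expR K <= q%:R].
  by near: q; apply: near_prime_power.
by rewrite -[K]expRK ler_ln ?posrE ?expR_gt0// (lt_le_trans (expR_gt0 K)).
Unshelve. all: by end_near. Qed.

(** With [y = q ^ (1 / (2 * d))], the numerator is [y ^ 2] and [ln q = 2 * d * ln y <= 2 * d * y],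
    so the quotient is at least [y / (2 * d)]. *)
Lemma unbounded_powR_div_ln (R : realType) (d : nat) : (0 < d)%N ->
  unbounded (fun q => q%:R `^ d%:R^-1 / ln q%:R : R).
Proof.
move=> d0 K; have dR : 0 < d%:R :> R by rewrite ltr0n.
pose e : R := (2 * d%:R)^-1; have e0 : 0 < e by rewrite invr_gt0 mulr_gt0.
pose K' : R := Num.max 0 (K * (2 * d%:R)).
near=> q.
have [_ q1 qK] : [/\ prime_power q, (1 < q)%N & K' `^ (2 * d%:R) <= q%:R].
  by near: q; apply: near_prime_power.
have lq1 : 1 <= ln q%:R :> R by near: q; apply: unbounded_ln.
have lq0 : 0 < ln q%:R :> R by apply: lt_le_trans lq1.
have qR0 : 0 < q%:R :> R by rewrite ltr0n ltnW.
set y : R := q%:R `^ e; have y0 : 0 < y by rewrite powR_gt0.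
have K'0 : 0 <= K' by rewrite le_max lexx.
have K'y : K' <= y.
  have := ge0_ler_powR (ltW e0) (powR_ge0 _ _ : _ \in Num.nneg)
    (ltW qR0 : _ \in Num.nneg) qK.
  by rewrite -powRrM mulfV ?powRr1// gt_eqF// mulr_gt0.
have yy : q%:R `^ d%:R^-1 = y * y :> R.
  rewrite -powRD; last by rewrite (gt_eqF qR0) implybT.
  by congr (_ `^ _); rewrite /e; field; rewrite gt_eqF.
have lny : ln q%:R <= 2 * d%:R * y.
  have := ltW (ln_sublinear y0); rewrite ln_powR /e mulrC ler_pdivrMr ?mulr_gt0//.
  by rewrite [leRHS]mulrC.
rewrite ler_pdivlMr// yy.
have [K0|K0] := leP K 0.
  by apply: (@le_trans _ _ 0); [rewrite mulr_le0_ge0// ltW|rewrite mulr_ge0 ?ltW].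
apply: (@le_trans _ _ (K * (2 * d%:R * y))); first by rewrite ler_wpM2l// ltW.
rewrite mulrA ler_wpM2r ?(ltW y0)//; apply: le_trans K'y.
by rewrite le_max lexx orbT.
Unshelve. all: by end_near. Qed.

Lemma unbounded_powR_ln2 (R : realType) (d : nat) : (0 < d)%N ->
  unbounded (fun q => q%:R `^ d%:R^-1 * ln q%:R ^+ 2 : R).
Proof.
move=> d0; apply: unbounded_le _ (unbounded_powR_div_ln d0); near=> q.
have lq1 : 1 <= ln q%:R :> R by near: q; apply: unbounded_ln.
rewrite ler_wpM2l ?powR_ge0//; apply: (@le_trans _ _ 1).
  by rewrite invf_le1// (lt_le_trans ltr01).
by rewrite exprn_ege1.
Unshelve. all: by end_near. Qed.

(** At the critical scales of [p], the mean [p * q] on the moment curve and the mean [p * q ^ d] in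
    the whole space both become [q ^ (1 / d)]. *)
Lemma powR_scale (R : realType) (d q : nat) : (1 < q)%N ->
  (q%:R `^ (-1 + d%:R^-1) * q%:R = q%:R `^ d%:R^-1 :> R) *
  (q%:R `^ (- d%:R + d%:R^-1) * q%:R ^+ d = q%:R `^ d%:R^-1 :> R).
Proof.
move=> q1; have qR0 : 0 < q%:R :> R by rewrite ltr0n ltnW.
split.
  rewrite -{2}[q%:R]powRr1 ?(ltW qR0)// -powRD; last by rewrite (gt_eqF qR0) implybT.
  by congr (_ `^ _); ring.
rewrite -powR_mulrn ?(ltW qR0)// -powRD; last by rewrite (gt_eqF qR0) implybT.
by congr (_ `^ _); ring.
Qed.

(** * The three ranges of [p] *)

Theorem claim3 (R : realType) (d : nat) (hd : (2 <= d)%N) :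
  balanced_supersaturation R d -> random_general_position R d.
Proof.
move=> BS; have d0 : (0 < d)%N by apply: leq_trans hd.
have [A [T [A0 T0 cont]]] := few_containers d0 BS.
have e0 : 0 < expR 1 :> R := expR_gt0 _.
have eT : 0 < expR 1 * T by rewrite mulr_gt0.
(* Large enough for both upper bounds, through containers and through [#|A|]. *)
pose c2 : R := A + expR 1 * T + expR 1 + 1.
have c_cont : A + expR 1 * T + 1 <= c2 by rewrite /c2; lra.
have c_card : expR 1 + 1 <= c2 by rewrite /c2; lra.
exists 1, 8^-1, c2; split.
  by split=> //; apply: lt_le_trans c_card; rewrite addr_gt0.
move=> p p01; split.
- move=> pbig psmall.
  have uM : unbounded (fun q => p q * q%:R ^+ d).
    move=> K; near=> q.
    have [_ q1 _] : [/\ prime_power q, (1 < q)%N & 0 <= q%:R :> R].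
      by near: q; apply: near_prime_power.
    have : K <= p q / q%:R `^ (- d%:R) by near: q; move/cvgryPge: pbig; apply.
    by rewrite powRN invrK powR_mulrn.
  apply: whp_alpha_betweenI => //; last exact: whp_alpha_le_card.
  apply: whp_alpha_ge_deletion => //.
    near=> q; apply: p01.
    suff [qq _ _] : [/\ prime_power q, (1 < q)%N & 0 <= q%:R :> R] by [].
    by near: q; apply: near_prime_power.
  move=> eta eta0; near=> q.
  have [_ q1 _] : [/\ prime_power q, (1 < q)%N & 0 <= q%:R :> R].
    by near: q; apply: near_prime_power.
  have : `|0 - p q / q%:R `^ (- d%:R + d%:R^-1)| <= eta.
    by near: q; move/cvgrPdist_le: psmall; apply.
  rewrite sub0r normrN => /(le_trans (ler_norm _)).
  by rewrite ler_pdivrMr// powR_gt0// ltr0n ltnW.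
- move=> pC.
  (* In (b), already with [C = 1], [p * q] dominates the exponent of the number of containers up to
     a constant, so [M = p * q] is admissible. *)
  have LM : \forall q \near W, q%:R `^ d%:R^-1 * ln q%:R ^+ 2 <= p q * q%:R.
    near=> q.
    have [_ q1 _] : [/\ prime_power q, (1 < q)%N & 0 <= q%:R :> R].
      by near: q; apply: near_prime_power.
    have /andP[h _] : 1 * q%:R `^ (-1 + d%:R^-1) * ln q%:R ^+ 2 <= p q <= 1.
      by near: q.
    by rewrite -(powR_scale R d q1).1 mulrAC ler_wpM2r// -[X in X * _]mul1r.
  have uM : unbounded (fun q => p q * q%:R).
    exact: unbounded_le LM (unbounded_powR_ln2 d0).
  rewrite (_ : (fun q => c2 * _ * _) = (fun q => c2 * (p q * q%:R))); last first.
    by apply/funext => q; rewrite mulrA.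
  apply: whp_alpha_betweenI => //; first exact: whp_alpha_ge_curve.
  apply: whp_alpha_containers cont c_cont p01 uM _ LM => //.
  exact: nearW.
move=> pC; apply: whp_alpha_betweenI => //; last first.
  apply: whp_alpha_containers cont _ _ _ _ _ => //.
  - exact: unbounded_powR_ln2.
  - near=> q.
    have [_ q1 _] : [/\ prime_power q, (1 < q)%N & 0 <= q%:R :> R].
      by near: q; apply: near_prime_power.
    have /andP[_ h] : q%:R `^ (- d%:R + d%:R^-1) / ln q%:R <= p q
            < 1 * q%:R `^ (-1 + d%:R^-1) * ln q%:R ^+ 2 by near: q.
    rewrite -(powR_scale R d q1).1 mulrAC ler_wpM2r//.
    by rewrite -[X in X * _]mul1r ltW.
  - exact: nearW.
have e_ln : \forall q \near W, 1 <= ln q%:R :> R by apply: unbounded_ln.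
(* The lower end of range (c): the logarithm makes [p'] negligible against [q ^ (- d + 1 / d)], so
   the deletion bound applies at [p'] and passes to [p] by monotonicity. *)
pose p' q : R := q%:R `^ (- d%:R + d%:R^-1) / ln q%:R.
have p'E : \forall q \near W, q%:R `^ d%:R^-1 / ln q%:R = p' q * q%:R ^+ d :> R.
  near=> q.
  have [_ q1 _] : [/\ prime_power q, (1 < q)%N & 0 <= q%:R :> R].
    by near: q; apply: near_prime_power.
  by rewrite /p' mulrAC (powR_scale R d q1).2.
have pp' : \forall q \near W, [/\ 0 <= p' q, p' q <= p q & p q <= 1].
  near=> q.
  have [qq q1 _] : [/\ prime_power q, (1 < q)%N & 0 <= q%:R :> R].
    by near: q; apply: near_prime_power.
  have lq1 : 1 <= ln q%:R :> R by near: q.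
  have /andP[h _] : q%:R `^ (- d%:R + d%:R^-1) / ln q%:R <= p q
          < 1 * q%:R `^ (-1 + d%:R^-1) * ln q%:R ^+ 2 by near: q.
  have /andP[_ p1] := p01 _ qq; split=> //.
  by rewrite divr_ge0 ?powR_ge0// (le_trans ler01).
apply: (@whp_alpha_ge_mono _ _ _ p' _ (fun q => 8^-1 * p' q * q%:R ^+ d)) => //.
  near=> q; rewrite -[leRHS]mulrA ler_wpM2l// le_eqVlt; apply/orP; left.
  by apply/eqP; near: q.
apply: whp_alpha_ge_deletion => //.
- near=> q.
  have [h1 h2 h3] : [/\ 0 <= p' q, p' q <= p q & p q <= 1] by near: q.
  by rewrite h1 (le_trans h2).
- apply: unbounded_le (unbounded_powR_div_ln d0); near=> q.
  by rewrite le_eqVlt; apply/orP; left; apply/eqP; near: q.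
move=> eta eta0; near=> q; rewrite /p' mulrC ler_wpM2r ?powR_ge0//.
have lq : eta^-1 <= ln q%:R by near: q; apply: unbounded_ln.
by rewrite invf_ple ?posrE// (lt_le_trans _ lq)// invr_gt0.
Unshelve. all: by end_near. Qed.
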